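(* Let $\pi,\tilde g,\gamma,\hat\pi,z,\hat z,\nu_\pi$ and $\hat T_\sharp\mu_{\rm uni}$ be as in the context, and let $\epsilon\ge 0$. Suppose that $$\|\tilde g-\sqrt{\pi}\|_{L^2_\lambda(\mathcal X)}\le\epsilon\qquad\text{and}\qquad \gamma\le\frac{1}{\lambda(\mathcal X)}\,\|\tilde g-\sqrt{\pi}\|^2_{L^2_\lambda(\mathcal X)} .$$ Then the Hellinger distance between $\nu_\pi$ and $\hat T_\sharp\mu_{\rm uni}$ satisfies $$D_{\rm H}(\nu_\pi\,\|\,\hat T_\sharp\mu_{\rm uni})\le \frac{2\epsilon}{\sqrt z}.$$
   Context: $\mathcal X=\mathcal X_1\times\cdots\times\mathcal X_d$ with $\mathcal X_k\subseteq\mathbb R$. $\lambda(x)=\prod_{i=1}^d\lambda_i(x_i)$ is a nonnegative Lebesgue measurable product weight; $\lambda_i(\mathcal X_i)=\int_{\mathcal X_i}\lambda_i(x_i)\,dx_i$ and $\lambda(\mathcal X)=\prod_{i}\lambda_i(\mathcal X_i)$ is a finite positive constant. $\|f\|_{L^p_\lambda(\mathcal X)}=\big(\int_{\mathcal X}|f(x)|^p\lambda(x)\,dx\big)^{1/p}$. Target: $\pi:\mathcal X\to[0,\infty)$, $\pi\in L^1_\lambda(\mathcal X)$, is an unnormalised density, $z=\int_{\mathcal X}\pi(x)\lambda(x)\,dx>0$, and $\nu_\pi$ is the probability measure with Lebesgue density $\frac1z\pi(x)\lambda(x)$. Approximation: $\tilde g:\mathcal X\to\mathbb R$ is a function in $L^2_\lambda(\mathcal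 X)$ of tensor-train form $\tilde g(x)=\mathsf G_1(x_1)\cdots\mathsf G_d(x_d)$, with matrix-valued $\mathsf G_k:\mathcal X_k\to\mathbb R^{r_{k-1}\times r_k}$, $r_0=r_d=1$ (an approximation of $\sqrt\pi$). $\gamma>0$ is a constant, $\hat\pi(x)=\gamma+\tilde g(x)^2$, $\hat z=\gamma\lambda(\mathcal X)+\int_{\mathcal X}\tilde g(x)^2\lambda(x)\,dx$, $\hat f(x)=\frac1{\hat z}\hat\pi(x)\lambda(x)$. The squared inverse Rosenblatt transport $\hat T:[0,1]^d\to\mathcal X$ is the inverse of the lower-triangular Rosenblatt map $x\mapsto(F_1(x_1),F_2(x_2|x_1),\ldots,F_d(x_d|x_1,\ldots,x_{d-1}))$ built from the marginal and conditional cumulative distribution functions of $\hat f$. With $\mu_{\rm uni}$ the uniform measure on $[0,1]^d$, the pushforward $\hat T_\sharp\mu_{\rm uni}$ is the probability measure with density $\hat f$. The Hellinger distance of two probability measures with Lebesgue densities $p,q$ is $D_{\rm H}=\big(\tfrac12\int(\sqrt p-\sqrt q)^2dx\big)^{1/2}$. *)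

(* Defs.v *)
From HB Require Import structures.
From mathcomp Require Import all_boot all_order all_algebra.
From mathcomp Require Import all_classical all_reals all_analysis.
Set Implicit Arguments.
Unset Strict Implicit.
Unset Printing Implicit Defensive.
Import Order.TTheory GRing.Theory Num.Theory.
Import numFieldNormedType.Exports.
Local Open Scope classical_set_scope.
Local Open Scope ring_scope.

(* R^n with its product Borel sigma-algebra. *)
Notation Rn R n := (n.-tuple (measurableTypeR R)).

Section lebesgue_tuple.
Local Open Scope ereal_scope.
Context (R : realType).

Definition cons_pair n (p : measurableTypeR R * Rn R n) : Rn R n.+1 :=
  [tuple of p.1 :: p.2].

Definition lebesgue_cons n (m : {sigma_finite_measure set (Rn R n) -> \bar R}) :
    set (Rn R n.+1) -> \bar R :=
  pushforward (@lebesgue_measure R \x m) (@cons_pair n).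

Section instances.
Variables (n : nat) (m : {sigma_finite_measure set (Rn R n) -> \bar R}).

Let mcons A : measurable A -> measurable (@cons_pair n @^-1` A).
Proof.
move=> mA; rewrite -[X in measurable X]setTI.
have mc : measurable_fun [set: measurableTypeR R * Rn R n] (@cons_pair n).
  exact: measurable_cons.
exact: mc.
Qed.

Let lebesgue_cons0 : lebesgue_cons m set0 = 0.
Proof. by rewrite /lebesgue_cons /pushforward preimage_set0 measure0. Qed.

Let lebesgue_cons_ge0 A : 0 <= lebesgue_cons m A.
Proof. exact: integral_ge0. Qed.

Let lebesgue_cons_sigma_additive : semi_sigma_additive (lebesgue_cons m).
Proof.
move=> F mF tF mUF; rewrite /lebesgue_cons /pushforward preimage_bigcup.
apply: measure_semi_sigma_additive.
- by move=> k; exact: mcons.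
- apply/trivIsetP => /= i j _ _ ij; rewrite -preimage_setI.
  by move/trivIsetP : tF => /(_ _ _ _ _ ij) ->//; rewrite preimage_set0.
- by rewrite -preimage_bigcup; exact: mcons.
Qed.

HB.instance Definition _ := isMeasure.Build _ _ _ (lebesgue_cons m)
  lebesgue_cons0 lebesgue_cons_ge0 lebesgue_cons_sigma_additive.

Let lebesgue_cons_sigma_finite : sigma_finite setT (lebesgue_cons m).
Proof.
have /sigma_finiteP[F [TF ndF Foo]] := sigma_finiteT (@lebesgue_measure R).
have /sigma_finiteP[G [TG ndG Goo]] := sigma_finiteT m.
pose B k := [set x : Rn R n.+1 | F k (thead x) /\ G k [tuple of behead x]].
have consB k : @cons_pair n @^-1` B k = F k `*` G k.
  apply/seteqP; split => -[t y] [/=]; rewrite /B/= theadE.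
    by move=> Ft Gy; split => //=; congr (G k _) : Gy; exact: val_inj.
  by move=> Ft Gy; split => //=; congr (G k _) : Gy; exact: val_inj.
have mtl := @measurable_behead _ (measurableTypeR R) n.
exists B.
  apply/esym; rewrite -subTset => x _.
  have [i _ Fi] : (\bigcup_k F k) (thead x) by rewrite -TF.
  have [j _ Gj] : (\bigcup_k G k) [tuple of behead x] by rewrite -TG.
  exists (maxn i j) => //; split.
    by move: Fi; exact/subsetPset/ndF/leq_maxl.
  by move: Gj; exact/subsetPset/ndG/leq_maxr.
move=> k; have [mF Fk] := Foo k; have [mG Gk] := Goo k; split.
  apply: measurableI.
    by rewrite -[X in measurable X]setTI; exact: (@measurable_tnth _ _ n.+1 ord0).
  by rewrite -[X in measurable X]setTI; exact: mtl.
rewrite /lebesgue_cons /pushforward consB product_measure1E//.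
by rewrite lte_mul_pinfty// ge0_fin_numE.
Qed.

HB.instance Definition _ := Measure_isSigmaFinite.Build _ _ _ (lebesgue_cons m)
  lebesgue_cons_sigma_finite.

End instances.

Fixpoint lebesgue n : {sigma_finite_measure set (Rn R n) -> \bar R} :=
  match n with
  | 0%N => @dirac _ _ [tuple] R
  | n'.+1 => lebesgue_cons (lebesgue n')
  end.

End lebesgue_tuple.
Arguments lebesgue {R} n.

(* Measurability for the completion of mu (Lebesgue, as opposed to Borel,
   measurability when mu is the Lebesgue measure): agreement mu-almost
   everywhere with a measurable set, resp. with a measurable function on D. *)
Section completion_measurability.
Context d (T : measurableType d) (R : realType) (mu : set T -> \bar R).

Definition completion_measurable (D : set T) : Prop :=
  exists2 B : set T, measurable B & {ae mu, forall x, D x <-> B x}.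

Definition completion_measurable_fun d' (U : measurableType d') (D : set T)
    (f : T -> U) : Prop :=
  exists2 h : T -> U, measurable_fun setT h & {ae mu, forall x, D x -> f x = h x}.

End completion_measurability.

Section weighted_spaces.
Context (R : realType) (d : nat).

Definition box (Xk : 'I_d -> set R) : set (Rn R d) :=
  [set x | forall i, Xk i (tnth x i)].

Definition prod_weight (lamk : 'I_d -> R -> R) (x : Rn R d) : R :=
  \prod_i lamk i (tnth x i).

Definition weight_mass (Xk : 'I_d -> set R) (lamk : 'I_d -> R -> R) : \bar R :=
  (\prod_i \int[@lebesgue_measure R]_(t in Xk i) (lamk i t)%:E)%E.

Definition wLnorm (X : set (Rn R d)) (lam : Rn R d -> R) (p : R)
    (f : Rn R d -> R) : \bar R :=
  ((\int[lebesgue d]_(x in X) (`|f x| `^ p * lam x)%:E) `^ p^-1)%E.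

Definition wintegral (X : set (Rn R d)) (lam f : Rn R d -> R) : R :=
  fine (\int[lebesgue d]_(x in X) (f x * lam x)%:E).

(* G_1(x_1) ... G_k(x_k); cores and coordinates are numbered from 0. *)
Fixpoint tt_product (r : nat -> nat) (G : forall k, R -> 'M[R]_(r k, r k.+1))
    (x : Rn R d) (k : nat) : 'M[R]_(r 0%N, r k) :=
  match k with
  | 0%N => 1%:M
  | k'.+1 => tt_product G x k' *m G k' (nth 0 x k')
  end.

Definition zero_outside (X : set (Rn R d)) (f : Rn R d -> R) (x : Rn R d) : R :=
  if x \in X then f x else 0.

End weighted_spaces.

Section rosenblatt.
Context (R : realType) (d : nat).
Implicit Types (f : Rn R d -> R) (x : Rn R d).

(* (x_1, ..., x_k, y_1, ..., y_{d-k}) *)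
Definition splice (k : nat) x (y : Rn R (d - k)) : Rn R d :=
  [tuple if (i < k)%N then tnth x i else nth 0 y (i - k) | i < d].

(* Marginal density of the first k coordinates; it only depends on x_1..x_k,
   and it is the total mass of f for k = 0. *)
Definition marginal f (k : nat) x : \bar R :=
  (\int[lebesgue (d - k)]_y (f (splice x y))%:E)%E.

Definition set_coord (k : 'I_d) (t : R) x : Rn R d :=
  [tuple if i == k then t else tnth x i | i < d].

(* For k : 'I_d, the density of x_{k+1} given x_1, ..., x_k. *)
Definition cond_density f (k : 'I_d) x : R :=
  fine (marginal f k.+1 x) / fine (marginal f k x).

Definition cond_cdf f (k : 'I_d) x : R :=
  fine (\int[@lebesgue_measure R]_(t in `]-oo, tnth x k])
          (cond_density f k (set_coord k t x))%:E)%E.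

Definition rosenblatt f x : Rn R d := [tuple cond_cdf f k x | k < d].

Definition unit_cube : set (Rn R d) :=
  [set u | forall i, 0 <= tnth u i <= 1].

Definition mu_uni (A : set (Rn R d)) : \bar R := lebesgue d (A `&` unit_cube).

(* T inverts the Rosenblatt map of the density f on X. As a conditional CDF need
   not attain 0 or 1 (unbounded X), nor be injective where f vanishes, the two
   inversion identities can only hold almost everywhere: for the uniform measure,
   and for the measure with density f. *)
Definition inverse_rosenblatt (X : set (Rn R d)) f (T : Rn R d -> Rn R d) : Prop :=
  [/\ completion_measurable_fun (lebesgue d) unit_cube T,
      {ae lebesgue d, forall u, unit_cube u -> X (T u)},
      {ae lebesgue d, forall u, unit_cube u -> rosenblatt f (T u) = u} &
      {ae lebesgue d, forall x, X x -> 0 < f x -> T (rosenblatt f x) = x}].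

End rosenblatt.
Arguments mu_uni {R d}.

Section hellinger.
Context (R : realType) (d : nat).
Local Open Scope ereal_scope.
Implicit Types (P Q : set (Rn R d) -> \bar R) (p : Rn R d -> R).

Definition has_density P p : Prop :=
  [/\ measurable_fun setT p, forall x, (0 <= p x)%R &
      forall A, measurable A -> P A = \int[lebesgue d]_(x in A) (p x)%:E].

(* A Lebesgue density of P, unique almost everywhere; the default value 0 is
   only used for measures that have no density. *)
Definition density P : Rn R d -> R := xget (fun=> 0%R) [set p | has_density P p].

Definition hellinger P Q : \bar R :=
  ((2^-1)%:E * \int[lebesgue d]_x
     ((Num.sqrt (density P x) - Num.sqrt (density Q x)) ^+ 2)%:E) `^ (2^-1).

End hellinger.

Section squared_transport.
Context (R : realType) (d : nat) (Xk : 'I_d -> set R) (lamk : 'I_d -> R -> R).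
Let X := box Xk.
Let lam := prod_weight lamk.

Definition target_measure (pi : Rn R d -> R) (A : set (Rn R d)) : \bar R :=
  (\int[lebesgue d]_(x in A `&` X) (pi x * lam x / wintegral X lam pi)%:E)%E.

Definition pi_hat (g : Rn R d -> R) (gamma : R) (x : Rn R d) : R :=
  gamma + g x ^+ 2.

Definition z_hat (g : Rn R d -> R) (gamma : R) : R :=
  gamma * fine (weight_mass Xk lamk) + wintegral X lam (fun x => g x ^+ 2).

Definition f_hat (g : Rn R d -> R) (gamma : R) : Rn R d -> R :=
  zero_outside X (fun x => pi_hat g gamma x * lam x / z_hat g gamma).

End squared_transport.

(* Main.v *)
(* The Rosenblatt map of a density f is built coordinate by coordinate: on a point
   (t, y) it is F(t) followed by the Rosenblatt map of the section f(t, .) at y,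
   where F is the distribution function of the first marginal. By induction on the
   dimension, Fubini and the one-dimensional fact that F pushes its law to the
   uniform law, it pushes f dx to the uniform measure of the cube. Since T undoes
   it f-almost everywhere, T pushes the uniform measure to f dx.

   For the distance, put x = sqrt pi, y = sqrt pi_hat, a^2 = z, b^2 = z_hat and
   N = |x - y|^2 in L^2_lambda. Then |x/a - y/b|^2 = (N - (a - b)^2)/(ab), which is
   at most 4 N / a^2, and pointwise (x - y)^2 <= gamma + (g - sqrt pi)^2 gives
   N <= gamma lambda(X) + eps^2 <= 2 eps^2.

   Lebesgue-measurable data are first replaced by almost everywhere equal Borel
   data. *)
Require Import Defs.
From HB Require Import structures.
From mathcomp Require Import all_boot all_order all_algebra.
From mathcomp Require Import all_classical all_reals all_analysis.
From mathcomp Require Import measurable_realfun archimedean ring lra.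
Set Implicit Arguments.
Unset Strict Implicit.
Unset Printing Implicit Defensive.
Import Order.TTheory GRing.Theory Num.Theory.
Import numFieldNormedType.Exports.
Local Open Scope classical_set_scope.
Local Open Scope ring_scope.

(** * Almost-everywhere statements: combination rules *)

Section ae_logic.
Context d (T : measurableType d) (R : realType) (mu : {measure set T -> \bar R}).
Implicit Types P Q S : T -> Prop.

Lemma ae_all P : (forall x, P x) -> {ae mu, forall x, P x}.
Proof. by move=> Px; exists set0; split => // x /(_ (Px x)). Qed.

Lemma ae_imp P Q : (forall x, P x -> Q x) ->
  {ae mu, forall x, P x} -> {ae mu, forall x, Q x}.
Proof. by move=> PQ; apply: filterS. Qed.

Lemma ae_imp2 P Q S : (forall x, P x -> Q x -> S x) ->
  {ae mu, forall x, P x} -> {ae mu, forall x, Q x} -> {ae mu, forall x, S x}.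
Proof. by move=> PQS; apply: filterS2. Qed.

(** Reduces to the countable case by listing [I] as a sequence, padded with [True] beyond its
    end. *)
Lemma ae_forall_fin (I : finType) (P : I -> T -> Prop) :
  (forall i, {ae mu, forall x, P i x}) -> {ae mu, forall x, forall i, P i x}.
Proof.
move=> aeP.
have : {ae mu, forall x, forall k : nat, nth True [seq P i x | i <- enum I] k}.
  apply: ae_foralln => k; have [i0 _|noI] := pickP (@predT I); last first.
    by apply: ae_all => x; rewrite (eq_enum noI) enum0 nth_nil.
  have [kI|kI] := ltnP k (size (enum I)); last first.
    by apply: ae_all => x; rewrite nth_default// size_map.
  by apply: ae_imp (aeP (nth i0 (enum I) k)) => x; rewrite (nth_map i0).
apply: ae_imp => x Px i; have := Px (index i (enum I)).
by rewrite (nth_map i) ?nth_index ?index_mem ?mem_enum.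
Qed.

End ae_logic.

(** * Integrals of functions that agree almost everywhere *)

Section lower_integral.
Context d (T : measurableType d) (R : realType) (mu : {measure set T -> \bar R}).
Local Open Scope ereal_scope.
Import HBNNSimple.

Let lower_integral (f : T -> \bar R) := ereal_sup [set sintegral mu h |
  h in [set h : {nnsfun T >-> R} | forall x, (h x)%:E <= f x]].

(** A simple function below [f], set to 0 on the null set [N] where [f] and [g] differ, lies below
    [g] and keeps its integral. Measurability is thus used only for simple functions and for [N]. *)
Let lower_integral_le f g : {ae mu, forall x, f x = g x} ->
  (forall x, 0 <= g x) -> lower_integral f <= lower_integral g.
Proof.
move=> [N [mN N0 fgN]] g0; apply/ge_ereal_sup => /= _ [h hf <-].
have mCN := measurableC mN.
pose h' : {nnsfun T >-> R} := proj_nnsfun h mCN.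
have h'E x : h' x = if x \in N then 0%R else h x.
  by rewrite /h' -mrestrict patchE in_setC; case: (x \in N).
apply: ereal_sup_ubound; exists h'.
  move=> x; rewrite h'E; case: ifPn => [//|xN]; apply: (le_trans (hf x)).
  suff -> : f x = g x by [].
  by apply: contrapT => /fgN Nx; rewrite mem_set in xN.
rewrite -!integralT_nnsfun; apply: ge0_ae_eq_integral => //.
- exact/measurable_EFinP.
- exact/measurable_EFinP.
- by move=> x _; rewrite lee_fin.
- by move=> x _; rewrite lee_fin.
- exists N; split=> // x /not_implyP[_]; apply: contra_notP => xN.
  by rewrite h'E memNset.
Qed.

(* The library integral is defined for every function, as a difference of lower
   integrals, so changing the integrand or the domain on a null set preserves it
   even when neither is measurable. *)
Lemma ae_eq_lower_integral D E (f g : T -> \bar R) :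
  {ae mu, forall x, (f \_ D) x = (g \_ E) x} ->
  \int[mu]_(x in D) f x = \int[mu]_(x in E) g x.
Proof.
have le_int u v : {ae mu, forall x, u x = v x} -> (forall x, 0 <= u x) ->
    (forall x, 0 <= v x) -> lower_integral u = lower_integral v.
  move=> uv u0 v0; apply/eqP; rewrite eq_le !lower_integral_le//.
  by apply: filterS uv => x ->.
move=> fg; rewrite /integral; congr (_ - _); apply: le_int => //.
- by apply: filterS fg => x; rewrite !funeposE => ->.
- by apply: filterS fg => x; rewrite !funenegE => ->.
Qed.

End lower_integral.

(** * Lebesgue measure on tuples: Tonelli and null sets by sections *)

Section lebesgue_tuple_theory.
Context (R : realType).
Local Open Scope ereal_scope.
Implicit Types n : nat.

Definition tcons n (t : R) (y : Rn R n) : Rn R n.+1 := [tuple of t :: y].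

Lemma tcons_surj n (x : Rn R n.+1) : exists t y, x = tcons t y.
Proof. by case/tupleP: x => t y; exists t, y; exact: val_inj. Qed.

Lemma measurable_tcons n :
  measurable_fun setT (fun p : measurableTypeR R * Rn R n => tcons p.1 p.2).
Proof. exact: measurable_cons. Qed.

Lemma measurable_tcons_r n (t : R) : measurable_fun setT (@tcons n t).
Proof. exact: measurable_cons. Qed.

(** The product measure is by definition the integral of the measures of the sections, so this holds
    for every set [A], Borel or not. *)
Lemma lebesgueSE n (A : set (Rn R n.+1)) :
  lebesgue n.+1 A =
  \int[@lebesgue_measure R]_t lebesgue n [set y | A (tcons t y)].
Proof.
apply: eq_integral => t _ /=; congr (lebesgue n _).
by apply/seteqP; split => y /=; rewrite /xsection /= inE.
Qed.

Lemma integral_lebesgueS n (f : Rn R n.+1 -> \bar R) :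
  measurable_fun setT f -> (forall x, 0 <= f x) ->
  \int[lebesgue n.+1]_x f x =
  \int[@lebesgue_measure R]_t \int[lebesgue n]_y f (tcons t y).
Proof.
move=> mf f0; rewrite [LHS](@ge0_integral_pushforward _ _ _ _ R (@cons_pair R n))//.
- rewrite preimage_setT /= fubini_tonelli1//.
  by apply: measurableT_comp => //; exact: measurable_tcons.
- exact: measurable_tcons.
Qed.

Lemma measurable_integral_tcons n (f : Rn R n.+1 -> \bar R) :
  measurable_fun setT f -> (forall x, 0 <= f x) ->
  measurable_fun setT (fun t : measurableTypeR R => \int[lebesgue n]_y f (tcons t y)).
Proof.
move=> mf f0.
apply: (@measurable_fun_fubini_tonelli_F _ _ _ _ R (lebesgue n)
  (fun p => f (tcons p.1 p.2))) => //.
by apply: measurableT_comp => //; exact: measurable_tcons.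
Qed.

Lemma measurable_lebesgue_slice n (A : set (Rn R n.+1)) : measurable A ->
  measurable_fun setT
    (fun t : measurableTypeR R => lebesgue n [set y | A (tcons t y)]).
Proof.
move=> mA.
rewrite (_ : (fun t => _) = (lebesgue n \o
  xsection ((fun p : measurableTypeR R * Rn R n => tcons p.1 p.2) @^-1` A))).
  apply: measurable_fun_xsection.
  by rewrite -[X in measurable X]setTI; exact: measurable_tcons.
apply/funext => t /=; congr (lebesgue n _).
by apply/seteqP; split => y /=; rewrite /xsection /= inE.
Qed.

Lemma measurable_slice n (A : set (Rn R n.+1)) t : measurable A ->
  measurable [set y | A (tcons t y)].
Proof.
by move=> mA; rewrite -[X in measurable X]setTI; exact: measurable_tcons_r.
Qed.

(** A nonnegative measurable function has integral 0 exactly when it vanishes almost everywhere;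
    here the function is the measure of the section. *)
Lemma lebesgueS_eq0 n (A : set (Rn R n.+1)) : measurable A ->
  lebesgue n.+1 A = 0 <->
  {ae @lebesgue_measure R, forall t, lebesgue n [set y | A (tcons t y)] = 0}.
Proof.
move=> mA; rewrite lebesgueSE; have mL := measurable_lebesgue_slice mA.
rewrite -[X in X = 0 <-> _](_ : \int[@lebesgue_measure R]_t
    `|lebesgue n [set y | A (tcons t y)]| = _); last first.
  by apply: eq_integral => t _; rewrite gee0_abs.
split=> [/(ae_eq_integral_abs _ measurableT mL)|H].
  by apply: filterS => t /(_ I).
apply/(ae_eq_integral_abs _ measurableT mL).
by case: H => N [mN N0 HN]; exists N; split=> // t Ht; apply: HN => /= E; apply: Ht.
Qed.

Lemma ae_slice n (P : Rn R n.+1 -> Prop) : {ae lebesgue n.+1, forall x, P x} ->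
  {ae @lebesgue_measure R, forall t, {ae lebesgue n, forall y, P (tcons t y)}}.
Proof.
move=> [N [mN /(lebesgueS_eq0 mN) N0 PN]].
apply: ae_imp N0 => t N0; exists [set y | N (tcons t y)]; split => //.
  exact: measurable_slice.
by move=> y /= Py; exact: PN.
Qed.

Lemma lebesgue0E (A : set (Rn R 0)) : lebesgue 0 A = \d_([tuple]) A.
Proof. by []. Qed.

(* On a non-Borel set [lebesgue n] is an iterated lower integral of sections. *)
Lemma lebesgue_ae_eq n (A B : set (Rn R n)) : measurable B ->
  {ae lebesgue n, forall x, A x <-> B x} -> lebesgue n A = lebesgue n B.
Proof.
elim: n => [|n IH] in A B *.
  move=> mB [N [mN]]; rewrite !lebesgue0E => N0 AB; rewrite !diracE.
  suff -> : A = B by [].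
  have h x : A x <-> B x.
    apply: contrapT => /AB; rewrite (tuple0 x) => Nx.
    by move/eqP: N0; rewrite diracE mem_set// onee_eq0.
  by apply/seteqP; split => x /h.
move=> mB AB; rewrite !lebesgueSE; apply: ae_eq_lower_integral.
rewrite !patch_setT; apply: ae_imp (ae_slice AB) => t.
apply: IH; exact: measurable_slice.
Qed.

End lebesgue_tuple_theory.

(** * Integration against a measure given by a density *)

Section integral_density.
Context d (T : measurableType d) (R : realType).
Variables (mu P : {measure set T -> \bar R}) (p : T -> R).
Hypotheses (mp : measurable_fun setT p) (p0 : forall x, 0 <= p x).
Local Open Scope ereal_scope.
Hypothesis PE : forall A, measurable A -> P A = \int[mu]_(x in A) (p x)%:E.
Import HBNNSimple.

Let integral_density_nnsfun (h : {nnsfun T >-> R}) :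
  \int[P]_x (h x)%:E = \int[mu]_x ((h x)%:E * (p x)%:E).
Proof.
have hE x : (h x)%:E = \sum_(k \in range h) (k * \1_(h @^-1` [set k]) x)%:E.
  by rewrite fsumEFin// fimfunE.
under eq_integral do rewrite hE.
rewrite ge0_integral_fsum//; last 2 first.
- by move=> y; exact/measurable_EFinP/measurable_funM.
- by move=> y x _; rewrite nnfun_muleindic_ge0.
under [RHS]eq_integral => x _.
  rewrite hE ge0_mule_fsuml; last by move=> k; rewrite EFinM nnfun_muleindic_ge0.
  over.
rewrite ge0_integral_fsum//; last 2 first.
- move=> y; apply: emeasurable_funM; apply/measurable_EFinP => //.
  exact/measurable_funM.
- by move=> y x _; rewrite mule_ge0 ?lee_fin// -lee_fin EFinM nnfun_muleindic_ge0.
apply: eq_fsbigr => r _; have mr : measurable (h @^-1` [set r]) by [].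
rewrite integralZl_indic_nnsfun// integral_indic// setIT PE//.
(* A negative [r] is not a value of [h], so both terms vanish; otherwise [r] is nonnegative and can
   be pulled out of the integral. *)
have [r0|r0] := ltP r 0%R.
  have -> : h @^-1` [set r] = set0 by exact: preimage_nnfun0.
  rewrite integral_set0 mule0 integral0_eq// => x _.
  by rewrite indic0 mulr0 mul0e.
under [RHS]eq_integral do rewrite EFinM -muleA.
rewrite [RHS]ge0_integralZl//.
- congr (_ * _); rewrite integral_mkcond; apply: eq_integral => x _.
  by rewrite patchE indicE; case: (_ \in _); rewrite ?mul1e ?mul0e.
- by apply: emeasurable_funM; apply/measurable_EFinP.
- by move=> x _; rewrite mule_ge0 ?lee_fin.
Qed.

(** Monotone convergence along simple functions increasing to [g], on both sides. *)
Lemma ge0_integral_density (g : T -> \bar R) : measurable_fun setT g ->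
  (forall x, 0 <= g x) -> \int[P]_x g x = \int[mu]_x (g x * (p x)%:E).
Proof.
move=> mg g0; pose h := nnsfun_approx measurableT mg.
transitivity (limn (fun n => \int[P]_x (h n x)%:E)).
  rewrite -monotone_convergence//.
  - apply: eq_integral => x _; apply/esym/cvg_lim => //.
    exact: cvg_nnsfun_approx.
  - by move=> n; exact/measurable_EFinP.
  - by move=> n x _; rewrite lee_fin.
  - by move=> x _ m n mn; rewrite lee_fin; exact/lefP/nd_nnsfun_approx.
under eq_fun do rewrite integral_density_nnsfun.
rewrite -monotone_convergence//.
- apply: eq_integral => x _; apply/cvg_lim => //.
  by apply: cvgeZr => //; exact: cvg_nnsfun_approx.
- by move=> n; apply: emeasurable_funM; exact/measurable_EFinP.
- by move=> n x _; rewrite mule_ge0// lee_fin.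
- move=> x _ m n mn; apply: lee_pmul; rewrite ?lee_fin//.
  exact/lefP/nd_nnsfun_approx.
Qed.

End integral_density.

(** * The one-dimensional transform: a distribution function sends its law to the uniform law *)

Section probability_integral_transform.
Context (R : realType) (p : measurableTypeR R -> R).
Hypotheses (mp : measurable_fun setT p) (p0 : forall x, 0 <= p x).
Local Open Scope ereal_scope.
Local Notation leb := (@lebesgue_measure R).
Hypothesis p1 : \int[leb]_x (p x)%:E = 1.

Let mEp D : measurable_fun D (EFin \o p).
Proof. by apply: measurable_funTS; exact/measurable_EFinP. Qed.

(** The law with density [p]. It is registered as a probability, and the identity as a random
    variable [X], so that the general facts on [cdf X] (monotonicity, limits, right continuity)
    apply to [F]. *)
Let P (A : set (measurableTypeR R)) := \int[leb]_(x in A) (p x)%:E.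

Let P0 : P set0 = 0. Proof. exact: integral_set0. Qed.

Let P_ge0 A : 0 <= P A.
Proof. by apply: integral_ge0 => x _; rewrite lee_fin. Qed.

Let P_sigma_additive : semi_sigma_additive P.
Proof.
move=> A mA tA mUA; rewrite /P ge0_integral_bigcup//.
- by apply: is_cvg_ereal_nneg_natsum_cond => n _ _; exact: P_ge0.
- by move=> x _; rewrite lee_fin.
Qed.

HB.instance Definition _ := isMeasure.Build _ _ _ P P0 P_ge0 P_sigma_additive.

Let PT : P setT = 1. Proof. exact: p1. Qed.

HB.instance Definition _ := @Measure_isProbability.Build _ _ R P PT.

Let idTR : measurableTypeR R -> R := idfun.
HB.instance Definition _ :=
  @isMeasurableFun.Build _ _ _ _ idTR (@measurable_id _ _ setT).
Let X : {RV P >-> R} := idTR.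

Definition density_cdf (t : R) : R := fine (\int[leb]_(x in `]-oo, t]) (p x)%:E).
Local Notation F := density_cdf.

Let cdfE t : cdf X t = (F t)%:E.
Proof.
rewrite /cdf /distribution /pushforward preimage_id /F fineK//.
exact: (fin_num_measure P).
Qed.

Let fcdfE : fine \o cdf X = F.
Proof. by apply/funext => t; rewrite -[RHS]/(fine (F t)%:E) -cdfE. Qed.

Let PE t : P `]-oo, t] = (F t)%:E.
Proof. by rewrite -cdfE /cdf /distribution /pushforward preimage_id. Qed.

Let F_nd : {homo F : x y / (x <= y)%R}.
Proof. by move=> x y xy; rewrite -lee_fin -!cdfE cdf_nondecreasing. Qed.

Lemma density_cdf_ge0 t : (0 <= F t)%R.
Proof. by rewrite -lee_fin -cdfE cdf_ge0. Qed.

Lemma density_cdf_le1 t : (F t <= 1)%R.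
Proof. by rewrite -lee_fin -cdfE cdf_le1. Qed.

Lemma measurable_density_cdf : measurable_fun setT (F : measurableTypeR R -> measurableTypeR R).
Proof. exact: nondecreasing_measurable. Qed.

(** A law with a density has no atom, so the endpoint carries no mass. *)
Let P_itvo t : P `]-oo, t[ = (F t)%:E.
Proof. by rewrite -PE /P integral_itv_bndo_bndc//; exact: mEp. Qed.

(** The set [S] is a nonempty down-set. If it is bounded, with supremum [s], then [F s = c] and [S]
    lies between []-oo, s[] and []-oo, s]], which both have mass [c]. *)
Let P_lt_cdf c : (0 < c <= 1)%R -> P [set t | (F t < c)%R] = c%:E.
Proof.
move=> /andP[c0 c1]; set S := [set t | _].
have mS : measurable S.
  rewrite (_ : S = setT `&` F @^-1` `]-oo, c[%classic); first exact: measurable_density_cdf.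
  by rewrite setTI; apply/seteqP; split => t /=; rewrite in_itv.
have Sd x y : (x <= y)%R -> S y -> S x.
  by move=> xy; apply: le_lt_trans; exact: F_nd.
have [s0 Ss0] : exists t, S t.
  have /fine_cvg := cvg_cdfNy0 X; rewrite fcdfE.
  by move/cvgr_lt => /(_ _ c0) /filter_ex[t Ftc]; exists t.
have [ubS|nubS] := pselect (has_ubound S); last first.
  (* An unbounded down-set is the whole line, so [F < c] everywhere; since [F] tends to 1, this
     forces [c = 1]. *)
  have ST t : S t.
    apply: contrapT => St; apply: nubS; exists t => y Sy.
    by rewrite leNgt; apply/negP => ty; apply: St; exact: (Sd _ _ (ltW ty)).
  have -> : S = setT by rewrite -subTset => t _.
  rewrite PT; apply/eqP; rewrite eq_le [X in _ && X]lee_fin c1 andbT.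
  have := cvg_cdfy1 X; apply: cvge_le.
  by apply: nearW => t; rewrite cdfE lee_fin ltW// ST.
have supS : has_sup S by split => //; exists s0.
set s := sup S.
have sS t : (t < s)%R -> S t.
  rewrite -subr_gt0 => ts; have [u Su] := sup_adherent ts supS.
  by rewrite subKr => /ltW /Sd; exact.
have Ss t : S t -> (t <= s)%R by move=> St; exact: ub_le_sup.
(* If [F s < c], right continuity keeps [F] below [c] just after [s], and [S] would contain a point
   beyond its supremum. *)
have cFs : (c <= F s)%R.
  rewrite leNgt; apply/negP => Fsc.
  have := @cdf_right_continuous _ _ _ P X s.
  rewrite cdfE => /fine_cvg; rewrite fcdfE; move/cvgr_lt => /(_ _ Fsc) Fc.
  have [t [St]] := @filter_ex _ _ (at_right_proper_filter s) _ (filterI Fc (nbhs_right_gt s)).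
  by apply/negP; rewrite -leNgt; exact: Ss.
(* The half-line []-oo, s[] has mass [F s] and is the increasing union of the [I n], whose masses
   are values of [F] at points of [S], hence below [c]. *)
have Fsc : (F s <= c)%R.
  rewrite -lee_fin -P_itvo.
  pose I n : set (measurableTypeR R) := `]-oo, (s - n.+1%:R^-1)%R]%classic.
  have mI n : measurable (I n) by exact: measurable_itv.
  have -> : `]-oo, s[%classic = \bigcup_n I n.
    apply/seteqP; split=> [t|t [n _]]; rewrite /I /= !in_itv/=.
      rewrite -subr_gt0 => /ltr_add_invr[n]; rewrite add0r => nts.
      by exists n => //=; rewrite in_itv/= lerBrDr -lerBrDl ltW.
    by move=> /le_lt_trans; apply; rewrite ltrBlDr ltrDl invr_gt0.
  have : P (I n) @[n --> \oo] --> P (\bigcup_n I n).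
    apply: nondecreasing_cvg_mu => //; first exact: bigcupT_measurable.
    move=> m n mn; apply/subsetPset => t; rewrite /I /= !in_itv/= => /le_trans.
    by apply; rewrite lerD2l lerN2 lef_pV2 ?posrE// ler_nat ltnS.
  apply: cvge_le; apply: nearW => n; rewrite PE lee_fin ltW//.
  by apply: sS; rewrite ltrBlDr ltrDl invr_gt0.
have Fs : F s = c by apply/eqP; rewrite eq_le Fsc.
apply/eqP; rewrite eq_le -{1}Fs -PE -Fs -P_itvo; apply/andP; split.
  by apply: le_measure; rewrite ?inE// => t /Ss; rewrite /= in_itv.
by apply: le_measure; rewrite ?inE// => t; rewrite /= in_itv/= => /sS.
Qed.

Let FR : measurableTypeR R -> measurableTypeR R := F.
HB.instance Definition _ := isMeasurableFun.Build _ _ _ _ FR measurable_density_cdf.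

(** The half-lines []-oo, c[] generate the Borel sets and are stable under intersection, so it
    suffices to compare the two measures there. The values of [F] lie in [0, 1], which settles
    [c <= 0] and [c > 1]; [P_lt_cdf] gives the rest. *)
Let pushforward_density_cdf A : measurable A ->
  distribution P FR A = mrestr leb (measurable_itv `[0%R, 1%R]) A.
Proof.
apply: (@measure_unique _ R (measurableTypeR R) (@RGenInftyO.G R)
  (fun n : nat => `]-oo, n%:R[%classic)) A.
- exact: RGenInftyO.measurableE.
- move=> _ _ [x ->] [y ->]; exists (Num.min x y).
  by apply/seteqP; split=> t /=; rewrite !in_itv/= lt_min => /andP.
- by move=> n; exists n%:R.
- rewrite -subTset => x _; exists (Num.truncn x).+1 => //=.
  by rewrite in_itv/= truncnS_gt.
- move=> _ [c ->]; transitivity (P [set t | (F t < c)%R]).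
    by congr (P _); apply/seteqP; split => t /=; rewrite in_itv.
  rewrite -[RHS]/(leb (`]-oo, c[%classic `&` `[0%R, 1%R]%classic)).
  have [c0|c0] := leP c 0%R.
    rewrite (_ : [set t | _] = set0) ?P0; last first.
      apply/seteqP; split => // t /= Ftc.
      by have := le_lt_trans (density_cdf_ge0 t) Ftc; rewrite ltNge c0.
    rewrite (_ : _ `&` _ = set0) ?measure0//.
    apply/seteqP; split => // t /= []; rewrite !in_itv/= => tc /andP[t0 _].
    by have := le_lt_trans t0 tc; rewrite ltNge c0.
  have [c1|c1] := leP c 1%R.
    rewrite P_lt_cdf ?c0// (_ : _ `&` _ = `[0%R, c[%classic).
      by rewrite lebesgue_measure_itv/= lte_fin c0 oppr0 adde0.
    apply/seteqP; split => t /=; rewrite !in_itv/=.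
      by move=> [-> /andP[->]].
    by move=> /andP[-> tc]; rewrite tc (le_trans (ltW tc) c1).
  rewrite (_ : [set t | _] = setT) ?PT; last first.
    by rewrite -subTset => t _ /=; exact: le_lt_trans (density_cdf_le1 t) c1.
  rewrite (_ : _ `&` _ = `[0%R, 1%R]%classic).
    by rewrite lebesgue_measure_itv/= lte_fin ltr01 oppr0 adde0.
  apply/seteqP; split => t /=; rewrite !in_itv/=.
    by move=> [_ ->].
  by move=> /andP[-> t1]; rewrite t1 (le_lt_trans t1 c1).
- by move=> n; apply: (le_lt_trans (probability_le1 (distribution P FR) _)); rewrite ?ltry.
Qed.

Lemma ge0_probability_integral_transform (phi : measurableTypeR R -> \bar R) :
  measurable_fun setT phi -> (forall u, 0 <= phi u) ->
  \int[leb]_t (phi (F t) * (p t)%:E) =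
  \int[leb]_u (phi u * (\1_(`[0%R, 1%R]%classic : set R) u)%:E).
Proof.
move=> mphi phi0.
rewrite -(@ge0_integral_density _ _ _ leb P)//; last first.
  exact: (measurableT_comp mphi measurable_density_cdf).
rewrite -(@ge0_integral_density _ _ _ leb
  (mrestr leb (measurable_itv `[0%R, 1%R])))//; last first.
  move=> A mA; rewrite integral_indic// setIC//.
transitivity (\int[distribution P FR]_u phi u).
  by rewrite ge0_integral_pushforward// preimage_setT.
by apply: eq_measure_integral => A mA _; exact: pushforward_density_cdf.
Qed.

End probability_integral_transform.

(** * The Rosenblatt map by recursion on the dimension *)

Section rosenblatt_recursion.
Context (R : realType).
Local Notation leb := (@lebesgue_measure R).

Definition slice n (f : Rn R n.+1 -> R) (t : R) (y : Rn R n) : R := f (tcons t y).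

(** This statement and the next typecheck because [n.+1 - 0] and [n.+1 - k.+1] reduce to [n.+1] and
    [n - k]. *)
Lemma splice0 n (x : Rn R n.+1) (w : Rn R n.+1) :
  @splice R n.+1 0 x w = w.
Proof.
apply: eq_from_tnth => i; rewrite tnth_mktuple ltn0 (tnth_nth 0).
by congr nth; exact: subn0.
Qed.

Lemma spliceS n k t (y : Rn R n) (w : Rn R (n - k)) :
  @splice R n.+1 k.+1 (tcons t y) w = tcons t (splice y w).
Proof.
apply: eq_from_tnth => i; rewrite tnth_mktuple.
case: (unliftP ord0 i) => [j|] ->; last by rewrite tnth0.
by rewrite !tnthS tnth_mktuple lift0 ltnS.
Qed.

Lemma marginal0 n (f : Rn R n.+1 -> R) x :
  marginal f 0 x = (\int[lebesgue n.+1]_w (f w)%:E)%E.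
Proof. by apply: eq_integral => w _; rewrite splice0. Qed.

Lemma marginalS n (f : Rn R n.+1 -> R) k t y :
  marginal f k.+1 (tcons t y) = marginal (slice f t) k y.
Proof. by apply: eq_integral => w _; rewrite spliceS. Qed.

Lemma set_coord0 n s t (y : Rn R n) : set_coord ord0 s (tcons t y) = tcons s y.
Proof.
apply: eq_from_tnth => i; rewrite tnth_mktuple.
by case: (unliftP ord0 i) => [j|] ->; rewrite ?tnth0 ?tnthS.
Qed.

Lemma set_coordS n (k : 'I_n) s t (y : Rn R n) :
  set_coord (lift ord0 k) s (tcons t y) = tcons t (set_coord k s y).
Proof.
apply: eq_from_tnth => i; rewrite tnth_mktuple.
case: (unliftP ord0 i) => [j|] ->.
  by rewrite (inj_eq lift_inj) !tnthS tnth_mktuple.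
by rewrite !tnth0; case: eqP.
Qed.

Lemma cond_densityS n (f : Rn R n.+1 -> R) (k : 'I_n) t y :
  cond_density f (lift ord0 k) (tcons t y) = cond_density (slice f t) k y.
Proof. by rewrite /cond_density lift0 !marginalS. Qed.

Lemma cond_cdfS n (f : Rn R n.+1 -> R) (k : 'I_n) t y :
  cond_cdf f (lift ord0 k) (tcons t y) = cond_cdf (slice f t) k y.
Proof.
rewrite /cond_cdf tnthS; congr fine; apply: eq_integral => s _.
by rewrite set_coordS cond_densityS.
Qed.

Definition head_marginal n (f : Rn R n.+1 -> R) (t : R) : \bar R :=
  (\int[lebesgue n]_y (slice f t y)%:E)%E.

Lemma marginal1 n (f : Rn R n.+1 -> R) t y :
  marginal f 1 (tcons t y) = head_marginal f t.
Proof.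
rewrite marginalS; case: n f y => [|n] f y; last exact: marginal0.
apply: eq_integral => w _; congr ((slice f t _)%:E).
by apply: eq_from_tnth => -[].
Qed.

Definition head_cdf n (f : Rn R n.+1 -> R) (t : R) : R :=
  density_cdf (fun s => fine (head_marginal f s) /
    fine (\int[lebesgue n.+1]_x (f x)%:E)) t.

(** The recursion behind the inductions on the dimension. A conditional density is a quotient of two
    marginals of one function, so the section [slice f t] enters without normalisation. *)
Lemma rosenblatt_tcons n (f : Rn R n.+1 -> R) t y :
  rosenblatt f (tcons t y) = tcons (head_cdf f t) (rosenblatt (slice f t) y).
Proof.
apply: eq_from_tnth => i; rewrite tnth_mktuple.
case: (unliftP ord0 i) => [j|] ->; first by rewrite tnthS tnth_mktuple cond_cdfS.
rewrite tnth0 /cond_cdf tnth0; congr fine; apply: eq_integral => s _.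
by rewrite set_coord0 /cond_density marginal1 marginal0.
Qed.

End rosenblatt_recursion.

(** * Borel measurability of the Rosenblatt map of a Borel density *)

Section rosenblatt_measurability.
Context (R : realType).
Local Notation leb := (@lebesgue_measure R).

Lemma measurable_splice n k :
  measurable_fun setT (fun p : Rn R n * Rn R (n - k) => splice p.1 p.2).
Proof.
apply/measurable_fun_tnthP => i.
case: (ltnP i k) => ik.
  rewrite (_ : _ \o _ = fun p => tnth p.1 i); last first.
    by apply/funext => p /=; rewrite tnth_mktuple ik.
  by apply: (@measurableT_comp _ _ _ _ _ _ (fun y => tnth y i)) => //; exact: measurable_tnth.
have ink : (i - k < n - k)%N by rewrite ltn_sub2r// (leq_ltn_trans ik).
rewrite (_ : _ \o _ = fun p => tnth p.2 (Ordinal ink)); last first.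
  by apply/funext => p /=; rewrite tnth_mktuple ltnNge ik /= (tnth_nth 0).
by apply: (@measurableT_comp _ _ _ _ _ _ (fun y => tnth y (Ordinal ink))) => //; exact: measurable_tnth.
Qed.

Lemma measurable_set_coord n (k : 'I_n) :
  measurable_fun setT (fun p : Rn R n * measurableTypeR R => set_coord k p.2 p.1).
Proof.
apply/measurable_fun_tnthP => i.
case: (eqVneq i k) => ik.
  rewrite (_ : _ \o _ = snd)//.
  by apply/funext => p /=; rewrite tnth_mktuple ik eqxx.
rewrite (_ : _ \o _ = fun p => tnth p.1 i); last first.
  by apply/funext => p /=; rewrite tnth_mktuple (negbTE ik).
by apply: (@measurableT_comp _ _ _ _ _ _ (fun y => tnth y i)) => //; exact: measurable_tnth.
Qed.

Section borel_density.
Variables (n : nat) (f : Rn R n -> R).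
Hypotheses (mf : measurable_fun setT f) (f0 : forall x, 0 <= f x).

Lemma marginal_ge0 k x : (0 <= marginal f k x)%E.
Proof. by apply: integral_ge0 => y _; rewrite lee_fin. Qed.

Lemma measurable_marginal k : measurable_fun setT (marginal f k).
Proof.
apply: (@measurable_fun_fubini_tonelli_F _ _ _ _ R (lebesgue (n - k))
  (fun p : Rn R n * Rn R (n - k) => (f (splice p.1 p.2))%:E)).
  apply/measurable_EFinP; apply: measurableT_comp => //.
  exact: measurable_splice.
by move=> p; rewrite lee_fin.
Qed.

Lemma measurable_cond_density k : measurable_fun setT (cond_density f k).
Proof.
have mfine j : measurable_fun setT (fun x => fine (marginal f j x)).
  by apply: measurableT_comp => //; exact: measurable_marginal.
(* The division is written as a power with exponent -1, whose measurability is known; the two agree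
   on nonnegative reals, 0 included. *)
rewrite (_ : cond_density f k = fun x =>
    fine (marginal f k.+1 x) * fine (marginal f k x) `^ (-1)); last first.
  by apply/funext => x; rewrite powR_inv1// fine_ge0// marginal_ge0.
apply: measurable_funM => //.
exact: (measurableT_comp (measurable_powR _) (mfine k)).
Qed.

Lemma cond_density_ge0 k x : 0 <= cond_density f k x.
Proof. by rewrite divr_ge0// fine_ge0// marginal_ge0. Qed.

Lemma measurable_cond_cdf k :
  measurable_fun setT (cond_cdf f k : Rn R n -> measurableTypeR R).
Proof.
(* The constraint on [t] moves into the integrand, so that the domain no longer depends on [x] and
   Tonelli gives measurability. *)
pose c (p : Rn R n * measurableTypeR R) :=
  if p.2 <= tnth p.1 k then cond_density f k (set_coord k p.2 p.1) else 0.
rewrite (_ : cond_cdf f k = fun x => fine (\int[leb]_t (c (x, t))%:E)%E); last first.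
  apply/funext => x; congr fine; rewrite integral_mkcond.
  apply: eq_integral => t _; rewrite patchE /c /= mem_setE in_itv/=.
  by case: ifP.
apply: measurableT_comp => //.
apply: (@measurable_fun_fubini_tonelli_F _ _ _ _ R leb (fun p => (c p)%:E)).
  apply/measurable_EFinP; apply: measurable_fun_ifT => //.
    apply: measurable_fun_ler => //.
    by apply: (@measurableT_comp _ _ _ _ _ _ (fun y => tnth y k)) => //; exact: measurable_tnth.
  apply: (@measurableT_comp _ _ _ _ _ _ (cond_density f k)).
    exact: measurable_cond_density.
  exact: measurable_set_coord.
by move=> p; rewrite lee_fin /c; case: ifP => // _; exact: cond_density_ge0.
Qed.

Lemma measurable_rosenblatt : measurable_fun setT (rosenblatt f).
Proof.
apply/measurable_fun_tnthP => i.
rewrite (_ : _ \o _ = cond_cdf f i); first exact: measurable_cond_cdf.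
by apply/funext => x /=; rewrite tnth_mktuple.
Qed.

End borel_density.
End rosenblatt_measurability.

(** * Changing the density on a null set changes the Rosenblatt map only on a null set *)

Section rosenblatt_null_sets.
Context (R : realType).
Local Notation leb := (@lebesgue_measure R).
Local Open Scope ereal_scope.

Lemma slice_indic n (N : set (Rn R n.+1)) t :
  slice (\1_N) t = \1_[set y | N (tcons t y)].
Proof.
by apply/funext => y; rewrite /slice !indicE; congr (_%:R); apply/idP/idP; rewrite !inE.
Qed.

Lemma marginal_indic0 n (N : set (Rn R n.+1)) x : measurable N ->
  marginal (\1_N) 0 x = lebesgue n.+1 N.
Proof. by move=> mN; rewrite marginal0 integral_indic// setIT. Qed.

(* Fubini does not turn 'for a.e. t, for a.e. y' into 'for a.e. (t, y)' without
   measurability, and [rosenblatt f] may fail to be measurable; hence the explicit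
   measurable set of good points, described by the marginals of [\1_N]. *)
Lemma eq_rosenblatt_off_null n (f g : Rn R n -> R) (N : set (Rn R n)) x :
  measurable N -> (forall x, ~ N x -> f x = g x) ->
  (forall k, (k < n)%N -> marginal (\1_N) k x = 0) ->
  rosenblatt f x = rosenblatt g x.
Proof.
elim: n => [|n IH] in f g N x *.
  by move=> _ _ _; apply: eq_from_tnth => -[].
move=> mN fg; have [t [y ->]] := tcons_surj x => N0.
have N0' : lebesgue n.+1 N = 0 by rewrite -(marginal_indic0 (tcons t y) mN) N0.
rewrite !rosenblatt_tcons; congr tcons; last first.
  apply: (IH _ _ [set y | N (tcons t y)]).
  - exact: measurable_slice.
  - by move=> w Nw; exact: fg.
  - by move=> k kn; rewrite -slice_indic -marginalS N0.
rewrite /head_cdf.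
have -> : \int[lebesgue n.+1]_x (f x)%:E = \int[lebesgue n.+1]_x (g x)%:E.
  apply: ae_eq_lower_integral; rewrite !patch_setT; exists N; split => // w /= fgw.
  by apply: contrapT => /fg fgw'; apply: fgw; rewrite fgw'.
congr fine; apply: ae_eq_lower_integral.
have := (lebesgueS_eq0 mN).1 N0'; apply: ae_imp => s Ns.
rewrite !patchE; case: ifPn => // _; congr ((fine _ / _)%:E).
apply: ae_eq_lower_integral; rewrite !patch_setT.
exists [set y | N (tcons s y)]; split => //; first exact: measurable_slice.
move=> w /= fgw; apply: contrapT => /fg fgw'; apply: fgw.
by rewrite /slice fgw'.
Qed.

(** For [k = 0] the marginal is the measure of [N]. Otherwise almost every section of [N] is null
    and the induction applies to it; the exceptional set [C] is Borel, so null sections make it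
    null. *)
Lemma ae_marginal_null n (N : set (Rn R n)) k : measurable N ->
  lebesgue n N = 0 -> (k < n)%N ->
  {ae lebesgue n, forall x, marginal (\1_N) k x = 0}.
Proof.
elim: n => [//|n IH] in N k * => mN N0 kn.
case: k kn => [_|k kn].
  by apply: ae_all => x; rewrite marginal_indic0.
pose C := [set x | marginal (\1_N) k.+1 x != 0].
have mC : measurable C.
  rewrite -[C]setTI; apply: emeasurable_neq => //.
  by apply: measurable_marginal.
exists C; split => //; last by move=> x /= /eqP.
apply/lebesgueS_eq0 => //.
have := (lebesgueS_eq0 mN).1 N0; apply: ae_imp => t Nt.
apply: measure_negligible; first exact: measurable_slice.
have := IH _ k (measurable_slice t mN) Nt kn; apply: negligibleS => y /=.
by rewrite /C/= marginalS slice_indic => /eqP.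
Qed.

Lemma ae_eq_rosenblatt n (f g : Rn R n -> R) :
  {ae lebesgue n, forall x, f x = g x} ->
  {ae lebesgue n, forall x, rosenblatt f x = rosenblatt g x}.
Proof.
move=> [N [mN N0 fgN]].
have : {ae lebesgue n, forall x, forall k : 'I_n, marginal (\1_N) k x = 0}.
  by apply: ae_forall_fin => k; exact: ae_marginal_null.
apply: ae_imp => x Nx; apply: (eq_rosenblatt_off_null mN).
  by move=> w Nw; apply: contrapT => /fgN.
by move=> k kn; exact: (Nx (Ordinal kn)).
Qed.

End rosenblatt_null_sets.

(** * The Rosenblatt map pushes a density to the uniform measure *)

Section rosenblatt_pushforward.
Context (R : realType).
Local Notation leb := (@lebesgue_measure R).

Lemma measurable_forall_ord d (T : measurableType d) n (A : 'I_n -> set T) :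
  (forall i, measurable (A i)) -> measurable [set x | forall i, A i x].
Proof.
move=> mA; rewrite (_ : [set _ | _] = \bigcap_(i in setT) A i).
  by apply: fin_bigcap_measurable => //; exact: finite_finset.
by apply/seteqP; split => [x Ax i _|x Ax i]; exact: Ax.
Qed.

Lemma measurable_unit_cube n : measurable (@unit_cube R n).
Proof.
apply: (@measurable_forall_ord _ _ n (fun i => [set u : Rn R n | 0 <= tnth u i <= 1])) => i.
rewrite -[X in measurable X]setTI.
exact: (@measurable_tnth _ (measurableTypeR R) n i measurableT _ (measurable_itv `[0, 1])).
Qed.

Lemma unit_cube_tcons n t (y : Rn R n) :
  unit_cube (tcons t y) <-> 0 <= t <= 1 /\ unit_cube y.
Proof.
split=> [H|[t01 H] i].
  by split=> [|i]; [have := H ord0; rewrite tnth0|have := H (lift ord0 i); rewrite tnthS].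
by case: (unliftP ord0 i) => [j|] ->; rewrite ?tnth0 ?tnthS.
Qed.

Local Open Scope ereal_scope.

(** Stated for any finite total mass because the induction applies it to sections, which are not
    normalised. *)
Lemma integral_rosenblatt n (f : Rn R n -> R) (B : set (Rn R n)) :
  measurable_fun setT f -> (forall x, (0 <= f x)%R) ->
  \int[lebesgue n]_x (f x)%:E < +oo -> measurable B ->
  \int[lebesgue n]_x ((\1_B (rosenblatt f x) * f x)%:E) =
  (\int[lebesgue n]_x (f x)%:E) * lebesgue n (B `&` @unit_cube R n).
Proof.
elim: n => [|n IH] in f B * => mf f0 fy mB.
  rewrite !integral_dirac//; last 2 first.
  - exact/measurable_EFinP.
  - apply/measurable_EFinP; apply: measurable_funM => //.
    apply: measurableT_comp => //; exact: measurable_rosenblatt.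
  rewrite !diracT !mul1e EFinM muleC (tuple0 (rosenblatt f _)); congr (_ * _).
  rewrite lebesgue0E diracE indicE; congr ((nat_of_bool _)%:R%:E); apply/idP/idP; rewrite !inE.
    by move=> B0; split => // -[].
  by case.
pose h := head_marginal f; pose M := \int[lebesgue n.+1]_x (f x)%:E.
have mEf : measurable_fun setT (EFin \o f) by exact/measurable_EFinP.
have h0 t : 0 <= h t by apply: integral_ge0 => y _; rewrite lee_fin; exact: f0.
have mh : measurable_fun setT (h : measurableTypeR R -> \bar R).
  by apply: (measurable_integral_tcons mEf) => x; rewrite lee_fin.
have hM : \int[leb]_t h t = M.
  by rewrite /M (integral_lebesgueS mEf)// => x; rewrite lee_fin.
pose G x := (\1_B (rosenblatt f x) * f x)%R.
have mG : measurable_fun setT G.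
  apply: measurable_funM => //.
  have m1B : measurable_fun setT (\1_B : Rn R n.+1 -> R) by exact: measurable_indic.
  exact: (measurableT_comp m1B (measurable_rosenblatt mf f0)).
have G0 x : (0 <= G x)%R by rewrite mulr_ge0// indicE.
have mEG : measurable_fun setT (EFin \o G) by exact/measurable_EFinP.
(* Zero mass is treated apart, since the normalised marginal [p] below divides by [M]. *)
have [M0|M0] := eqVneq M 0.
  rewrite -/M M0 mul0e; apply/eqP; rewrite eq_le; apply/andP; split; last first.
    by apply: integral_ge0 => x _; rewrite lee_fin; exact: G0.
  rewrite -M0; apply: ge0_le_integral => //.
  - by move=> x _; rewrite lee_fin; exact: G0.
  - by move=> x _; rewrite lee_fin ler_piMl// indicE; case: (_ \in _).
have M_ge0 : 0 <= M by apply: integral_ge0 => x _; rewrite lee_fin.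
have Mfin : M \is a fin_num by rewrite ge0_fin_numE.
have Mr0 : (0 < fine M)%R by rewrite fine_gt0// fy lt0e M0 M_ge0.
(* The marginal [h] has finite integral [M], so it is finite almost everywhere, and there [fine]
   loses nothing. *)
have hfin : {ae leb, forall t, h t \is a fin_num}.
  have ih : leb.-integrable setT h.
    apply/integrableP; split => //.
    by under eq_integral do rewrite gee0_abs//; rewrite hM.
  by apply: ae_imp (integrable_ae measurableT ih) => t; exact.
pose p t := (fine (h t) / fine M)%R.
have p0 t : (0 <= p t)%R by rewrite divr_ge0// ?fine_ge0// ltW.
have mp : measurable_fun setT (p : measurableTypeR R -> R).
  by apply: measurable_funM => //; exact: measurableT_comp.
have hp : {ae leb, forall t, M * (p t)%:E = h t}.
  apply: ae_imp hfin => t ht.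
  by rewrite /p -{1}(fineK Mfin) -EFinM mulrCA divff ?gt_eqF// mulr1 fineK.
have mEp : measurable_fun setT (EFin \o (p : measurableTypeR R -> R)).
  exact/measurable_EFinP.
have p1 : \int[leb]_t (p t)%:E = 1.
  transitivity ((fine M)^-1%:E * \int[leb]_t h t).
    rewrite -ge0_integralZl//; last by rewrite lee_fin invr_ge0 ltW.
    apply: ae_eq_lower_integral; rewrite !patch_setT; apply: ae_imp hfin => t ht.
    by rewrite /p -[in RHS](fineK ht) -EFinM mulrC.
  by rewrite hM -[in X in _ * X](fineK Mfin) -EFinM mulVf// gt_eqF.
(* By unfolding, [F] is [density_cdf p], so the one-dimensional results apply. *)
pose F := head_cdf f.
have F01 t : (0 <= F t <= 1)%R.
  by rewrite density_cdf_ge0// density_cdf_le1.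
have mF : measurable_fun setT (F : measurableTypeR R -> measurableTypeR R).
  exact: measurable_density_cdf.
have mBQ : measurable (B `&` @unit_cube R n.+1).
  by apply: measurableI => //; exact: measurable_unit_cube.
pose phi (u : measurableTypeR R) :=
  lebesgue n [set y | (B `&` @unit_cube R n.+1) (tcons u y)].
have mphi : measurable_fun setT phi by exact: measurable_lebesgue_slice.
have phi0 u : 0 <= phi u by [].
(* The induction hypothesis is applied to the section of [f] at [t], of mass [h t = M * p t], and to
   the section of [B] at [F t]. *)
transitivity (\int[leb]_t (M * (phi (F t) * (p t)%:E))).
  rewrite (integral_lebesgueS mEG); last by move=> x; rewrite lee_fin.
  apply: ae_eq_lower_integral; rewrite !patch_setT; apply: ae_imp2 hfin hp => t ht hpt.
  have msf : measurable_fun setT (slice f t).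
    by apply: measurableT_comp => //; exact: measurable_tcons_r.
  have hty : \int[lebesgue n]_y (slice f t y)%:E < +oo.
    by rewrite -ge0_fin_numE//; exact: h0.
  rewrite muleCA hpt muleC.
  have := IH (slice f t) _ msf (fun y => f0 _) hty (measurable_slice (F t) mB).
  rewrite (_ : lebesgue n _ = phi (F t)) => [<-|].
    by apply: eq_integral => y _; rewrite /G /= rosenblatt_tcons; congr ((_ * _)%:E).
  congr (lebesgue n _); apply/seteqP; split => y /=.
    by move=> [By Qy]; split => //; exact/unit_cube_tcons.
  by move=> [By /unit_cube_tcons[]].
rewrite ge0_integralZl//; last 2 first.
- apply: emeasurable_funM => //; exact: (measurableT_comp mphi mF).
- by move=> t _; rewrite mule_ge0// lee_fin.
congr (M * _); rewrite (ge0_probability_integral_transform mp p0 p1 mphi phi0).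
rewrite lebesgueSE; apply: eq_integral => u _.
(* For [u] outside [0, 1] the section of the cube is empty, so [phi u = 0]. *)
rewrite indicE; have [uI|uI] := boolP (u \in _); first by rewrite mule1.
rewrite mule0 /phi (_ : [set y | _] = set0) ?measure0//.
apply/seteqP; split => // y /= [_ /unit_cube_tcons[u01 _]].
by move: uI; rewrite mem_setE in_itv/= u01.
Qed.

End rosenblatt_pushforward.

(** * The density of the transported measure, and independence of the Hellinger distance from the
    chosen densities *)

Section transport_density.
Context (R : realType) (n : nat).
Local Open Scope ereal_scope.

Lemma pushforward_inverse_rosenblatt (X : set (Rn R n)) (f f0 : Rn R n -> R)
    (T : Rn R n -> Rn R n) :
  measurable_fun setT f0 -> (forall x, (0 <= f0 x)%R) ->
  \int[lebesgue n]_x (f0 x)%:E = 1 ->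
  {ae lebesgue n, forall x, f x = f0 x} ->
  (forall x, ~ X x -> f x = 0%R) ->
  inverse_rosenblatt X f T ->
  has_density (pushforward mu_uni T) f0.
Proof.
move=> mf0 f00 f01 ff0 fX [[h mh hT] _ _ TR]; split => // A mA.
have f0y : \int[lebesgue n]_x (f0 x)%:E < +oo by rewrite f01 ltry.
have mQ := @measurable_unit_cube R n.
have intR B : measurable B ->
    \int[lebesgue n]_x ((\1_B (rosenblatt f0 x) * f0 x)%:E) =
    lebesgue n (B `&` @unit_cube R n).
  by move=> mB; rewrite integral_rosenblatt// f01 mul1e.
(* Points sent by [rosenblatt f0] into a null part of the cube carry no [f0]-mass. This is used for
   the set [N] where [T] and its Borel version [h] may differ, and for the complement of the
   cube. *)
have nullR B : measurable B -> lebesgue n (B `&` @unit_cube R n) = 0 ->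
    {ae lebesgue n, forall x, B (rosenblatt f0 x) -> f0 x = 0%R}.
  move=> mB B0.
  have mg : measurable_fun setT (fun x => (\1_B (rosenblatt f0 x) * f0 x)%:E).
    apply/measurable_EFinP; apply: measurable_funM => //.
    have m1B : measurable_fun setT (\1_B : Rn R n -> R) by exact: measurable_indic.
    exact: (measurableT_comp m1B (measurable_rosenblatt mf0 f00)).
  have /(ae_eq_integral_abs _ measurableT mg) : \int[lebesgue n]_x
      `|(\1_B (rosenblatt f0 x) * f0 x)%:E| = 0.
    rewrite -B0 -intR//; apply: eq_integral => x _.
    by rewrite gee0_abs// lee_fin mulr_ge0// indicE.
  apply: ae_imp => x /(_ I) + Bx; rewrite indicE mem_set// mul1r.
  by move=> [].
have [N [mN N0 hTN]] := hT.
have aeN : {ae lebesgue n, forall x, N (rosenblatt f0 x) -> f0 x = 0%R}.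
  apply: nullR => //; apply: (subset_measure0 _ _ _ N0) => //; first exact: measurableI.
have aeQ : {ae lebesgue n, forall x, (~` @unit_cube R n) (rosenblatt f0 x) -> f0 x = 0%R}.
  apply: nullR; first exact: measurableC.
  by rewrite setICl measure0.
pose E := h @^-1` A `&` @unit_cube R n.
have mE : measurable E.
  by apply: measurableI => //; rewrite -[X in measurable X]setTI; exact: mh.
(* The preimage of [A] under [T] need not be Borel, but within the cube it agrees almost everywhere
   with the Borel set [E]. *)
transitivity (lebesgue n E).
  apply: lebesgue_ae_eq => //; apply: ae_imp hT => u hu.
  by split=> -[/= Au Qu]; split => //=; [rewrite -hu|rewrite hu].
rewrite (_ : E = E `&` @unit_cube R n); last by rewrite /E -setIA setIid.
rewrite -intR//; apply: ae_eq_lower_integral; rewrite patch_setT.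
have ae1 := ae_imp2 (fun x => @conj _ _) aeN aeQ.
have ae2 := ae_imp2 (fun x => @conj _ _) ff0 (ae_eq_rosenblatt ff0).
have ae3 := ae_imp2 (fun x => @conj _ _) ae1 ae2.
(* Where [f0 x] is nonzero, [u = rosenblatt f0 x] lies in the cube and outside [N], so
   [h u = T u = x]; hence [u] is in [E] exactly when [x] is in [A]. *)
apply: ae_imp2 ae3 TR => x [[xN xQ] [fx Rx]] TRx.
have [f0x|f0x] := eqVneq (f0 x) 0%R.
  by rewrite f0x mulr0 patchE; case: ifP => //; rewrite f0x.
have Xx : X x by apply: contrapT => /fX; rewrite fx => /eqP; rewrite (negbTE f0x).
have {TRx} : T (rosenblatt f0 x) = x.
  by rewrite -Rx; apply: TRx => //; rewrite fx lt0r f0x f00.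
set u := rosenblatt f0 x => Tu.
have Qu : unit_cube u by apply: contrapT => /xQ /eqP; rewrite (negbTE f0x).
have hu : h u = x.
  rewrite -[RHS]Tu; apply/esym; apply: contrapT => Thu.
  have /hTN : ~ (unit_cube u -> T u = h u) by move=> /(_ Qu).
  by move=> /xN /eqP; rewrite (negbTE f0x).
rewrite patchE indicE (_ : (u \in E) = (x \in A)); last first.
  by apply/idP/idP; rewrite !inE /E /= hu => // -[].
by case: (x \in A); rewrite ?mul1r ?mul0r.
Qed.

(** Finite mass makes [p] integrable, and an integrable function is determined almost everywhere by
    its integrals over measurable sets. *)
Lemma has_density_ae_eq (P : set (Rn R n) -> \bar R) (p q : Rn R n -> R) :
  has_density P p -> has_density P q -> P setT < +oo ->
  {ae lebesgue n, forall x, p x = q x}.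
Proof.
move=> [mp p0 Pp] [mq q0 Pq] Py.
have mEp : measurable_fun setT (EFin \o p) by exact/measurable_EFinP.
have mEq : measurable_fun setT (EFin \o q) by exact/measurable_EFinP.
have : ae_eq (lebesgue n) setT (EFin \o p) (EFin \o q).
  apply: integral_ae_eq => //.
    apply/integrableP; split => //.
    under eq_integral do rewrite gee0_abs ?lee_fin//.
    by rewrite -Pp.
  by move=> E _ mE; rewrite -Pp// Pq.
by apply: ae_imp => x /(_ I) [].
Qed.

(** [density] is a choice among almost everywhere equal functions, so any explicit densities may
    replace it. *)
Lemma hellinger_density (P Q : set (Rn R n) -> \bar R) (p q : Rn R n -> R) :
  has_density P p -> has_density Q q -> P setT < +oo -> Q setT < +oo ->
  hellinger P Q = ((2^-1)%:E * \int[lebesgue n]_x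
     ((Num.sqrt (p x) - Num.sqrt (q x)) ^+ 2)%:E) `^ (2^-1).
Proof.
move=> Pp Qq Py Qy; rewrite /hellinger; congr ((_ * _) `^ _).
have dP : has_density P (density P) by apply: xgetPex; exists p.
have dQ : has_density Q (density Q) by apply: xgetPex; exists q.
apply: ae_eq_lower_integral; rewrite !patch_setT.
by apply: ae_imp2 (has_density_ae_eq dP Pp Py) (has_density_ae_eq dQ Qq Qy) => x -> ->.
Qed.

End transport_density.

(** * Borel versions of the product weight *)

Section product_weight.
Context (R : realType).
Local Notation leb := (@lebesgue_measure R).
Local Open Scope ereal_scope.

(** A cylinder over a null set is null: its sections along the first coordinate are cylinders of
    lower dimension or, if [i] is the first index, empty for [t] outside [N]. *)
Lemma ae_tnth n (i : 'I_n) (P : R -> Prop) : {ae leb, forall t, P t} ->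
  {ae lebesgue n, forall x, P (tnth x i)}.
Proof.
move=> [N [mN N0 PN]]; exists [set x | N (tnth x i)].
have mC m (j : 'I_m) : measurable [set x : Rn R m | N (tnth x j)].
  rewrite -[X in measurable X]setTI.
  exact: (@measurable_tnth _ (measurableTypeR R) m j measurableT _ mN).
split; [exact: mC| |by move=> x /= Px; exact: PN].
elim: n => [[]//|n IH] in i *; apply/lebesgueS_eq0; first exact: mC.
case: (unliftP ord0 i) => [j|] ->.
  apply: ae_all => t; rewrite -[RHS](IH j); congr (lebesgue n _).
  by apply/seteqP; split => y /=; rewrite tnthS.
exists N; split => // t /= ; apply: contra_notP => Nt.
rewrite (_ : [set y | _] = set0) ?measure0//.
by apply/seteqP; split => // y /=; rewrite tnth0.
Qed.

Lemma measurable_prod_weight n (l : 'I_n -> R -> R) :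
  (forall i, measurable_fun setT (l i : measurableTypeR R -> R)) ->
  measurable_fun setT (prod_weight l).
Proof.
move=> ml; apply: measurable_prod => i _.
exact: (measurableT_comp (ml i) (@measurable_tnth _ (measurableTypeR R) n i)).
Qed.

Lemma prod_weight_ge0 n (l : 'I_n -> R -> R) x :
  (forall i t, 0 <= l i t)%R -> (0 <= prod_weight l x)%R.
Proof. by move=> l0; apply: prodr_ge0. Qed.

Lemma integral_prod_weight n (l : 'I_n -> R -> R) :
  (forall i, measurable_fun setT (l i : measurableTypeR R -> R)) ->
  (forall i t, 0 <= l i t)%R ->
  \int[lebesgue n]_x (prod_weight l x)%:E = \prod_i \int[leb]_t (l i t)%:E.
Proof.
elim: n => [|n IH] in l *; move=> ml l0.
  rewrite big_ord0 integral_dirac//; last first.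
    by apply/measurable_EFinP; exact: measurable_prod_weight.
  by rewrite diracT mul1e /prod_weight big_ord0.
rewrite integral_lebesgueS; last 2 first.
- by apply/measurable_EFinP; exact: measurable_prod_weight.
- by move=> x; rewrite lee_fin; exact: prod_weight_ge0.
rewrite big_ord_recl -(IH (fun i => l (lift ord0 i)))//.
rewrite -ge0_integralZr//; last 3 first.
- exact/measurable_EFinP.
- by move=> t _; rewrite lee_fin.
- by apply: integral_ge0 => y _; rewrite lee_fin; exact: prod_weight_ge0.
apply: eq_integral => t _; rewrite -ge0_integralZl//; last 3 first.
- by apply/measurable_EFinP; exact: measurable_prod_weight.
- by move=> y _; rewrite lee_fin; exact: prod_weight_ge0.
- by rewrite lee_fin.
apply: eq_integral => y _; rewrite -EFinM /prod_weight big_ord_recl tnth0.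
by congr ((_ * _)%:E); apply: eq_bigr => i _; rewrite tnthS.
Qed.

Lemma borel_weight (X : set R) (lam : R -> R) :
  completion_measurable leb X -> completion_measurable_fun leb X lam ->
  (forall t, X t -> (0 <= lam t)%R) ->
  exists l : R -> R, [/\ measurable_fun setT (l : measurableTypeR R -> R),
    forall t, (0 <= l t)%R &
    {ae leb, forall t, (X t -> l t = lam t) /\ (~ X t -> l t = 0%R)}].
Proof.
move=> [B mB XB] [h mh lamh] lam0.
(* The maximum with 0 makes the Borel version nonnegative everywhere, and the indicator of the Borel
   version [B] of [X] extends it by zero. *)
exists (fun t => Num.max 0 (h t) * \1_B t)%R; split.
- by apply: measurable_funM; [exact: measurable_maxr|exact: measurable_indic].
- by move=> t; rewrite mulr_ge0// ?indicE// le_max lexx.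
- apply: ae_imp2 XB lamh => t XBt lamt; split => Xt.
    by rewrite indicE mem_set ?mulr1 -?lamt//; [exact/max_idPr/lam0|exact/XBt].
  by rewrite indicE memNset ?mulr0// => /XBt.
Qed.

(** The weight [w] absorbs the domain: it vanishes almost everywhere off the box, so integrals over
    the box become integrals of Borel functions over the whole space. *)
Lemma borel_prod_weight n (Xk : 'I_n -> set R) (lamk : 'I_n -> R -> R) :
  (forall i, completion_measurable leb (Xk i)) ->
  (forall i, completion_measurable_fun leb (Xk i) (lamk i)) ->
  (forall i t, Xk i t -> (0 <= lamk i t)%R) ->
  exists w : Rn R n -> R, [/\ measurable_fun setT w, forall x, (0 <= w x)%R,
    \int[lebesgue n]_x (w x)%:E = weight_mass Xk lamk &
    {ae lebesgue n, forall x, (box Xk x -> w x = prod_weight lamk x) /\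
                              (~ box Xk x -> w x = 0%R)}].
Proof.
move=> mX mlam lam0.
have /choice[l Hl] i := borel_weight (mX i) (mlam i) (lam0 i).
have ml i : measurable_fun setT (l i : measurableTypeR R -> R) by have [] := Hl i.
have l0 i t : (0 <= l i t)%R by have [_ ->] := Hl i.
have lE i : {ae leb, forall t, (Xk i t -> l i t = lamk i t) /\
    (~ Xk i t -> l i t = 0%R)} by have [] := Hl i.
exists (prod_weight l); split.
- exact: measurable_prod_weight.
- by move=> x; exact: prod_weight_ge0.
- rewrite integral_prod_weight//; apply: eq_bigr => i _.
  apply: ae_eq_lower_integral; rewrite patch_setT.
  apply: ae_imp (lE i) => t [lX lNX]; rewrite patchE.
  by case: ifPn; [rewrite inE => /lX ->|rewrite notin_setE => /lNX ->].
- have : {ae lebesgue n, forall x, forall i,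
      (Xk i (tnth x i) -> l i (tnth x i) = lamk i (tnth x i)) /\
      (~ Xk i (tnth x i) -> l i (tnth x i) = 0%R)}.
    by apply: ae_forall_fin => i; exact: (ae_tnth i (lE i)).
  apply: ae_imp => x Hx; split=> [Xx|/existsNP[i NXi]].
    by apply: eq_bigr => i _; exact: (Hx i).1.
  by rewrite /prod_weight (bigD1 i)//= (Hx i).2// mul0r.
Qed.

End product_weight.

(** * Stability of the Hellinger distance under normalisation *)

Section hellinger_perturbation.

(** The bound involves [a] alone, so the delicate case is a small [b]; the threshold is [a = 4 * b].
    Below it, dropping the square [(a - b) ^+ 2] is enough. *)
Lemma hellinger_arith (R : realFieldType) (a b N : R) : 0 < a -> 0 < b ->
  0 <= N - (a - b) ^+ 2 -> N <= a ^+ 2 + b ^+ 2 ->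
  (N - (a - b) ^+ 2) / (a * b) <= 4 * N / a ^+ 2.
Proof.
move=> a0 b0 J0 Nab.
suff H : (N - (a - b) ^+ 2) * a <= 4 * N * b.
  have -> : (N - (a - b) ^+ 2) / (a * b) = (N - (a - b) ^+ 2) * a / (a ^+ 2 * b).
    by field; rewrite ?gt_eqF.
  have -> : 4 * N / a ^+ 2 = 4 * N * b / (a ^+ 2 * b).
    by field; rewrite ?gt_eqF.
  by rewrite ler_pM2r// invr_gt0 mulr_gt0// exprn_gt0.
have N0 : 0 <= N by have := sqr_ge0 (a - b); lra.
have [ab|ab] := leP a (4 * b).
  have h1 : (N - (a - b) ^+ 2) * a <= N * a by rewrite ler_pM2r// gerBl sqr_ge0.
  have h2 : N * a <= N * (4 * b) by rewrite ler_wpM2l.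
  lra.
(* For small [b] the upper bound on [N] gives [N - (a - b) ^+ 2 <= 2 * a * b], while
   [a - b >= 3 / 4 * a] gives [N >= a ^+ 2 / 2]; together they yield the claim. *)
have h1 : (N - (a - b) ^+ 2) * a <= (2 * a * b) * a by rewrite ler_pM2r//; nra.
have h2 : (a - b) ^+ 2 >= 2^-1 * a ^+ 2.
  have : (3 / 4 * a) ^+ 2 <= (a - b) ^+ 2 by rewrite lerXn2r// ?nnegrE; lra.
  have := sqr_ge0 a; lra.
have h3 : 2^-1 * a ^+ 2 * b <= N * b by rewrite ler_pM2r//; lra.
lra.
Qed.

(* The cross term [x y s^2] occurs only in the first summand on the right, so
   integrating needs no Cauchy-Schwarz inequality. *)
Lemma hellinger_identity (F : fieldType) (x y s a b : F) : a != 0 -> b != 0 ->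
  (x * s * a^-1 - y * s * b^-1) ^+ 2 =
  (a * b)^-1 * ((x - y) ^+ 2 * s ^+ 2) +
  ((a ^+ 2)^-1 - (a * b)^-1) * (x ^+ 2 * s ^+ 2) +
  ((b ^+ 2)^-1 - (a * b)^-1) * (y ^+ 2 * s ^+ 2).
Proof. by move=> a0 b0; field; rewrite a0 b0. Qed.

Context d (T : measurableType d) (R : realType) (mu : {measure set T -> \bar R}).
Variables (u v w : T -> R).
Hypotheses (m_u : measurable_fun setT u) (mv : measurable_fun setT v)
  (mw : measurable_fun setT w).
Hypotheses (u0 : forall x, 0 <= u x) (v0 : forall x, 0 <= v x)
  (w0 : forall x, 0 <= w x).
Variables (z z' K : R).
Hypotheses (z0 : 0 < z) (z'0 : 0 < z').
Local Open Scope ereal_scope.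
Hypotheses (uz : \int[mu]_x (u x * w x)%:E = z%:E)
  (vz' : \int[mu]_x (v x * w x)%:E = z'%:E)
  (uvK : \int[mu]_x ((Num.sqrt (u x) - Num.sqrt (v x)) ^+ 2 * w x)%:E <= K%:E).

Lemma sqr_hellinger_le :
  (2^-1)%:E * \int[mu]_x ((Num.sqrt (u x * w x / z) -
    Num.sqrt (v x * w x / z')) ^+ 2)%:E <= (2 * K / z)%:E.
Proof.
pose a := Num.sqrt z; pose b := Num.sqrt z'.
have a0 : (0 < a)%R by rewrite sqrtr_gt0.
have b0 : (0 < b)%R by rewrite sqrtr_gt0.
have a2 : (a ^+ 2 = z)%R by rewrite sqr_sqrtr// ltW.
have b2 : (b ^+ 2 = z')%R by rewrite sqr_sqrtr// ltW.
pose f1 x := ((Num.sqrt (u x) - Num.sqrt (v x)) ^+ 2 * w x)%R.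
pose f2 x := (u x * w x)%R; pose f3 x := (v x * w x)%R.
have msqrt (h : T -> R) : measurable_fun setT h ->
    measurable_fun setT (fun x => Num.sqrt (h x)).
  by move=> mh; apply: measurableT_comp => //; apply: continuous_measurable_fun; exact: sqrt_continuous.
have m2 : measurable_fun setT f2 by exact: measurable_funM.
have m3 : measurable_fun setT f3 by exact: measurable_funM.
have m1 : measurable_fun setT f1.
  apply: measurable_funM => //; apply: measurable_funX.
  by apply: measurable_funB; exact: msqrt.
have f10 x : (0 <= f1 x)%R by rewrite mulr_ge0// sqr_ge0.
have f20 x : (0 <= f2 x)%R by rewrite mulr_ge0.
have f30 x : (0 <= f3 x)%R by rewrite mulr_ge0.
(* Dropping the cross term gives both the finiteness of [N] and the bound [N <= a ^+ 2 + b ^+ 2]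
   required by [hellinger_arith]. *)
have f123 x : (f1 x <= f2 x + f3 x)%R.
  rewrite /f1 /f2 /f3 -mulrDl ler_wpM2r// sqrrB !sqr_sqrtr//.
  by rewrite -addrA [(- _ + _)%R]addrC addrA gerBl mulrn_wge0// mulr_ge0// sqrtr_ge0.
have int23 : \int[mu]_x (f2 x + f3 x)%:E = (z + z')%:E.
  under eq_integral do rewrite EFinD.
  rewrite ge0_integralD//; last 4 first.
  - by move=> x _; rewrite lee_fin.
  - exact/measurable_EFinP.
  - by move=> x _; rewrite lee_fin.
  - exact/measurable_EFinP.
  by rewrite uz vz' EFinD.
have int1 : \int[mu]_x (f1 x)%:E <= (z + z')%:E.
  rewrite -int23; apply: ge0_le_integral => //.
  - by move=> x _; rewrite lee_fin.
  - exact/measurable_EFinP.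
  - by apply/measurable_EFinP; exact: measurable_funD.
  - by move=> x _; rewrite lee_fin.
have int1fin : \int[mu]_x (f1 x)%:E \is a fin_num.
  rewrite ge0_fin_numE; first by rewrite (le_lt_trans int1)// ltry.
  by apply: integral_ge0 => x _; rewrite lee_fin.
set N := fine (\int[mu]_x (f1 x)%:E).
have NE : \int[mu]_x (f1 x)%:E = N%:E by rewrite fineK.
have intble (h : T -> R) (c : R) : measurable_fun setT h -> (forall x, 0 <= h x)%R ->
    \int[mu]_x (h x)%:E = c%:E -> mu.-integrable setT (EFin \o h).
  move=> mh h0 hc; apply/integrableP; split; first exact/measurable_EFinP.
  by under eq_integral do rewrite gee0_abs ?lee_fin//; rewrite hc ltry.
have i1 := intble _ _ m1 f10 NE.
have i2 := intble _ _ m2 f20 uz.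
have i3 := intble _ _ m3 f30 vz'.
pose c := (a * b)^-1%R.
have sqE x : ((Num.sqrt (u x * w x / z) - Num.sqrt (v x * w x / z')) ^+ 2 =
    c * f1 x + ((z^-1 - c) * f2 x + (z'^-1 - c) * f3 x))%R.
  rewrite !sqrtrM ?mulr_ge0// !sqrtrV ?ltW// -/a -/b.
  rewrite (hellinger_identity _ _ _ (lt0r_neq0 a0) (lt0r_neq0 b0)).
  by rewrite !sqr_sqrtr//; [rewrite -addrA|exact: ltW|exact: ltW].
have intE : \int[mu]_x ((Num.sqrt (u x * w x / z) -
    Num.sqrt (v x * w x / z')) ^+ 2)%:E =
    (c * N + ((z^-1 - c) * z + (z'^-1 - c) * z'))%:E.
  under eq_integral do rewrite sqE !EFinD !EFinM.
  rewrite integralD//; last 2 first.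
  - exact: integrableZl.
  - by apply: integrableD => //; exact: integrableZl.
  rewrite integralD//; [|exact: integrableZl|exact: integrableZl].
  by rewrite !integralZl// NE uz vz'.
have int0 : (0 <= c * N + ((z^-1 - c) * z + (z'^-1 - c) * z'))%R.
  by rewrite -lee_fin -intE; apply: integral_ge0 => x _; rewrite lee_fin sqr_ge0.
(* The two normalised masses add up to 2, which equals [c * (2 * a * b)]; this completes the square
   [(a - b) ^+ 2]. *)
have IE : (c * N + ((z^-1 - c) * z + (z'^-1 - c) * z') =
    (N - (a - b) ^+ 2) / (a * b))%R.
  by rewrite /c -a2 -b2; field; rewrite !gt_eqF.
have J0 : (0 <= N - (a - b) ^+ 2)%R.
  by move: int0; rewrite IE pmulr_lge0// invr_gt0 mulr_gt0.
have Nzz : (N <= a ^+ 2 + b ^+ 2)%R by rewrite a2 b2 -lee_fin -NE.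
have NK : (N <= K)%R by rewrite -lee_fin -NE.
rewrite intE IE -EFinM lee_fin.
have := hellinger_arith a0 b0 J0 Nzz; rewrite a2 => H.
have : (4 * N / z <= 4 * K / z)%R by rewrite ler_pM2r ?invr_gt0// ler_pM2l.
lra.
Qed.

End hellinger_perturbation.

(** * Weighted integrals and norms in terms of Borel data *)

Section squared_weights.
Context (R : realType) (n : nat) (X : set (Rn R n)) (lam w : Rn R n -> R).
Local Open Scope ereal_scope.
Hypothesis lamw : {ae lebesgue n, forall x,
  (X x -> w x = lam x) /\ (~ X x -> w x = 0%R)}.

Lemma eq_weighted_integral (A : set (Rn R n)) (p q : Rn R n -> R) :
  {ae lebesgue n, forall x, X x -> p x = q x} ->
  \int[lebesgue n]_(x in A `&` X) (p x * lam x)%:E =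
  \int[lebesgue n]_(x in A) (q x * w x)%:E.
Proof.
move=> pq; apply: ae_eq_lower_integral.
apply: ae_imp2 lamw pq => x [wX wNX] pqx; rewrite !patchE in_setI.
have [_|//] := ifPn (x \in A); rewrite /=.
by case: ifPn => [/set_mem Xx|/negP/(contra_not (@mem_set _ _ _)) Xx];
  [rewrite wX// pqx|rewrite wNX// mulr0].
Qed.

Lemma eq_weighted_integralT (p q : Rn R n -> R) :
  {ae lebesgue n, forall x, X x -> p x = q x} ->
  \int[lebesgue n]_(x in X) (p x * lam x)%:E =
  \int[lebesgue n]_x (q x * w x)%:E.
Proof. by move=> pq; rewrite -(eq_weighted_integral setT pq) setTI. Qed.

Lemma wLnorm2E (p q : Rn R n -> R) :
  {ae lebesgue n, forall x, X x -> p x = q x} ->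
  wLnorm X lam 2 p = (\int[lebesgue n]_x (q x ^+ 2 * w x)%:E) `^ 2^-1.
Proof.
move=> pq; rewrite /wLnorm; congr (_ `^ _); apply: eq_weighted_integralT.
apply: ae_imp pq => x pqx /pqx ->.
by rewrite powR_mulrn// real_normK// num_real.
Qed.

End squared_weights.

(** * The Hellinger bound for the squared transport *)

Theorem theorem1 (R : realType) (d : nat)
    (Xk : 'I_d -> set R) (lamk : 'I_d -> R -> R)
    (pi : Rn R d -> R)
    (r : nat -> nat) (G : forall k, R -> 'M[R]_(r k, r k.+1))
    (g : Rn R d -> R) (gamma eps : R) (T : Rn R d -> Rn R d)
    (X := box Xk) (lam := prod_weight lamk) (z := wintegral X lam pi)
    (Xk_meas : forall i, completion_measurable (@lebesgue_measure R) (Xk i))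
    (lamk_meas : forall i,
      completion_measurable_fun (@lebesgue_measure R) (Xk i) (lamk i))
    (lamk_ge0 : forall i t, Xk i t -> 0 <= lamk i t)
    (mass_gt0 : (0 < weight_mass Xk lamk)%E)
    (mass_fin : (weight_mass Xk lamk < +oo)%E)
    (pi_ge0 : forall x, X x -> 0 <= pi x)
    (pi_meas : completion_measurable_fun (lebesgue d) X pi)
    (pi_L1 : (wLnorm X lam 1 pi < +oo)%E)
    (z_gt0 : 0 < z)
    (r0 : r 0%N = 1%N) (rd : r d = 1%N)
    (g_tt : forall x, X x ->
      g x = castmx (r0, rd) (tt_product G x d) ord0 ord0)
    (g_meas : completion_measurable_fun (lebesgue d) X g)
    (g_L2 : (wLnorm X lam 2 g < +oo)%E)
    (gamma_gt0 : 0 < gamma)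
    (T_inv : inverse_rosenblatt X (f_hat Xk lamk g gamma) T)
    (eps_ge0 : 0 <= eps)
    (err : (wLnorm X lam 2 (fun x => (g x - Num.sqrt (pi x))%R) <= eps%:E)%E)
    (gamma_le : (gamma%:E <= (fine (weight_mass Xk lamk))^-1%:E *
        (wLnorm X lam 2 (fun x => (g x - Num.sqrt (pi x))%R)) ^+ 2)%E) :
  (hellinger (target_measure Xk lamk pi) (pushforward mu_uni T)
     <= (2 * eps / Num.sqrt z)%:E)%E.
Proof.
have [w [mw w0 wmass lamw]] := borel_prod_weight Xk_meas lamk_meas lamk_ge0.
have [hp mhp pihp] := pi_meas.
have [h mh gh] := g_meas.
(* A Borel version of [pi], made nonnegative everywhere. *)
pose q x := Num.max 0 (hp x).
have mq : measurable_fun setT q by exact: measurable_maxr.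
have q0 x : 0 <= q x by rewrite le_max lexx.
have piq : {ae lebesgue d, forall x, X x -> pi x = q x}.
  apply: ae_imp pihp => x pix Xx; rewrite /q -pix//.
  by apply/esym/max_idPr/pi_ge0.
have msqrt (u : Rn R d -> R) : measurable_fun setT u ->
    measurable_fun setT (fun x => Num.sqrt (u x)).
  move=> mu; apply: measurableT_comp => //; apply: continuous_measurable_fun.
  exact: sqrt_continuous.
set m := fine (weight_mass Xk lamk) in gamma_le.
have mE : weight_mass Xk lamk = m%:E.
  by rewrite fineK// ge0_fin_numE// ltW.
have m0 : 0 < m by rewrite -lte_fin -mE.
(* An infinite integral would give [z = 0] through [fine], so [z > 0] shows that the integral is
   finite. *)
have qz : (\int[lebesgue d]_x (q x * w x)%:E = z%:E)%E.
  have zE : z = fine (\int[lebesgue d]_x (q x * w x)%:E)%E.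
    by rewrite /z /wintegral (eq_weighted_integralT lamw piq).
  have : (0 <= \int[lebesgue d]_x (q x * w x)%:E)%E.
    by apply: integral_ge0 => x _; rewrite lee_fin mulr_ge0.
  by move: z_gt0; rewrite zE; case: (integral _ _ _) => //=; rewrite ltxx.
have h2y : (\int[lebesgue d]_x (h x ^+ 2 * w x)%:E < +oo)%E.
  move: g_L2; rewrite (wLnorm2E lamw gh); apply: lty_poweRy.
  by rewrite invr_eq0 pnatr_eq0.
have h2_ge0 : (0 <= \int[lebesgue d]_x (h x ^+ 2 * w x)%:E)%E.
  by apply: integral_ge0 => x _; rewrite lee_fin mulr_ge0// sqr_ge0.
pose s := fine (\int[lebesgue d]_x (h x ^+ 2 * w x)%:E)%E.
have sE : (\int[lebesgue d]_x (h x ^+ 2 * w x)%:E = s%:E)%E.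
  by rewrite fineK// ge0_fin_numE.
have s0 : 0 <= s by rewrite fine_ge0.
pose v x := gamma + h x ^+ 2.
have mv : measurable_fun setT v.
  by apply: measurable_funD => //; exact: measurable_funX.
have v0 x : 0 <= v x by rewrite addr_ge0 ?sqr_ge0// ltW.
(* Used with [h ^+ 2] to compute [z'] and with [e] in the final estimate; the constant contributes
   [c * m] because [w] has total mass [m]. *)
have intD (c : R) (u : Rn R d -> R) : 0 <= c -> measurable_fun setT u ->
    (forall x, 0 <= u x) -> (\int[lebesgue d]_x ((c + u x) * w x)%:E =
    (c * m)%:E + \int[lebesgue d]_x (u x * w x)%:E)%E.
  move=> c0 mu u0.
  under eq_integral do rewrite mulrDl EFinD.
  rewrite ge0_integralD//; last 4 first.
  - by move=> x _; rewrite lee_fin mulr_ge0.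
  - by apply/measurable_EFinP; exact: measurable_funM.
  - by move=> x _; rewrite lee_fin mulr_ge0.
  - by apply/measurable_EFinP; exact: measurable_funM.
  congr (_ + _)%E; under eq_integral do rewrite EFinM.
  rewrite ge0_integralZl//; last 2 first.
  - exact/measurable_EFinP.
  - by move=> x _; rewrite lee_fin.
  by rewrite wmass mE.
have mh2 : measurable_fun setT (fun x => h x ^+ 2) by exact: measurable_funX.
pose z' := gamma * m + s.
have vz' : (\int[lebesgue d]_x (v x * w x)%:E = z'%:E)%E.
  by rewrite intD ?ltW// ?sE// => x; exact: sqr_ge0.
have z'_gt0 : 0 < z' by rewrite ltr_wpDr// mulr_gt0.
have gh2 : {ae lebesgue d, forall x, X x -> g x ^+ 2 = h x ^+ 2}.
  by apply: ae_imp gh => x ghx /ghx ->.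
have z'E : z_hat Xk lamk g gamma = z'.
  rewrite /z_hat -/m /z'; congr (_ + _).
  by rewrite /wintegral (eq_weighted_integralT lamw gh2).
have errpq : {ae lebesgue d, forall x,
    X x -> g x - Num.sqrt (pi x) = h x - Num.sqrt (q x)}.
  by apply: ae_imp2 gh piq => x ghx pix Xx; rewrite ghx// pix.
pose e x := (h x - Num.sqrt (q x)) ^+ 2.
have me : measurable_fun setT e.
  by apply: measurable_funX; apply: measurable_funB => //; exact: msqrt.
have e0 x : 0 <= e x by exact: sqr_ge0.
pose E := (\int[lebesgue d]_x (e x * w x)%:E)%E.
move: err gamma_le; rewrite (wLnorm2E lamw errpq) -/E => errE gammaE.
have E_ge0 : (0 <= E)%E.
  by apply: integral_ge0 => x _; rewrite lee_fin mulr_ge0.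
have Efin : E \is a fin_num.
  rewrite ge0_fin_numE//; apply: (@lty_poweRy _ _ 2^-1).
    by rewrite invr_eq0 pnatr_eq0.
  by rewrite (le_lt_trans errE)// ltry.
have EE : E = (fine E)%:E by rewrite fineK.
have fE0 : 0 <= fine E by rewrite fine_ge0.
have fE_le : fine E <= eps ^+ 2.
  move: errE; rewrite EE poweR_EFin lee_fin powR12_sqrt// => H.
  by rewrite -(sqr_sqrtr fE0) lerXn2r// nnegrE sqrtr_ge0.
have gamma_le' : gamma * m <= fine E.
  move: gammaE; rewrite EE poweR_EFin powR12_sqrt// -EFin_expe -EFinM lee_fin.
  by rewrite sqr_sqrtr//= mulrC ler_pdivlMr.
(* Since [h <= sqrt v], replacing [sqrt v] by [h] in the cross term of the expanded square can only
   increase it, and [v = gamma + h ^+ 2] leaves [gamma + e]. *)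
have vqe x : (Num.sqrt (q x) - Num.sqrt (v x)) ^+ 2 <= gamma + e x.
  have hv : h x <= Num.sqrt (v x).
    rewrite (le_trans (ler_norm _))// -sqrtr_sqr ler_wsqrtr//.
    by rewrite lerDr ltW.
  have := ler_wpM2l (sqrtr_ge0 (q x)) hv.
  have := sqr_sqrtr (q0 x); have := sqr_sqrtr (v0 x); rewrite /e /v.
  set a := Num.sqrt (q x); set b := Num.sqrt _ => b2 a2 ab.
  have : (a - b) ^+ 2 = a ^+ 2 + b ^+ 2 - 2 * (a * b) by ring.
  have : (h x - a) ^+ 2 = h x ^+ 2 + a ^+ 2 - 2 * (a * h x) by ring.
  rewrite b2; lra.
(* The integral of [gamma + e] is [gamma * m + E], and each term is at most [eps ^+ 2]. *)
have dist_le : (\int[lebesgue d]_x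
    ((Num.sqrt (q x) - Num.sqrt (v x)) ^+ 2 * w x)%:E <= (2 * eps ^+ 2)%:E)%E.
  apply: (@le_trans _ _ (\int[lebesgue d]_x ((gamma + e x) * w x)%:E)%E).
    apply: ge0_le_integral => //.
    - by move=> x _; rewrite lee_fin mulr_ge0// sqr_ge0.
    - apply/measurable_EFinP; apply: measurable_funM => //.
      by apply: measurable_funX; apply: measurable_funB; exact: msqrt.
    - apply/measurable_EFinP; apply: measurable_funM => //.
      exact: measurable_funD.
    - by move=> x _; rewrite lee_fin ler_wpM2r.
  rewrite (intD _ _ (ltW gamma_gt0) me e0).
  by rewrite -/E EE -EFinD lee_fin; lra.
have dens1 (u : Rn R d -> R) (c : R) : 0 < c -> measurable_fun setT u ->
    (forall x, 0 <= u x) -> (\int[lebesgue d]_x (u x * w x)%:E = c%:E)%E ->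
    [/\ measurable_fun setT (fun x => u x * w x / c),
        forall x, 0 <= u x * w x / c &
        (\int[lebesgue d]_x (u x * w x / c)%:E = 1)%E].
  move=> c0 mu u0 uc; split.
  - by apply: measurable_funM => //; exact: measurable_funM.
  - by move=> x; rewrite divr_ge0 ?mulr_ge0// ltW.
  - under eq_integral do rewrite EFinM.
    rewrite ge0_integralZr//; last 3 first.
    + by apply/measurable_EFinP; exact: measurable_funM.
    + by move=> x _; rewrite lee_fin mulr_ge0.
    + by rewrite lee_fin invr_ge0 ltW.
    by rewrite uc -EFinM divff// gt_eqF.
have [mp p0 p1] := dens1 _ _ z_gt0 mq q0 qz.
have [mf f0 f1] := dens1 _ _ z'_gt0 mv v0 vz'.
have dp : has_density (target_measure Xk lamk pi) (fun x => q x * w x / z).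
  split => // A mA; rewrite /target_measure -/z.
  have piqz : {ae lebesgue d, forall x, X x -> pi x / z = q x / z}.
    by apply: ae_imp piq => x pix /pix ->.
  under eq_integral do rewrite mulrAC.
  rewrite (eq_weighted_integral lamw A piqz).
  by apply: eq_integral => x _; rewrite mulrAC.
have df : has_density (pushforward mu_uni T) (fun x => v x * w x / z').
  apply: (pushforward_inverse_rosenblatt (X := X) (f := f_hat Xk lamk g gamma)) => //.
  - apply: ae_imp2 lamw gh => x [wX wNX] ghx.
    rewrite /f_hat /zero_outside z'E.
    case: ifPn => [/set_mem Xx|/negP/(contra_not (@mem_set _ _ _)) Xx].
      by rewrite /pi_hat wX// ghx.
    by rewrite wNX// mulr0 mul0r.
  - by move=> x NXx; rewrite /f_hat /zero_outside memNset.
have Py : (target_measure Xk lamk pi setT < +oo)%E.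
  by have [_ _ ->//] := dp; rewrite p1 ltry.
have Qy : (pushforward mu_uni T setT < +oo)%E.
  by have [_ _ ->//] := df; rewrite f1 ltry.
rewrite (hellinger_density dp df Py Qy).
(* With [K = 2 * eps ^+ 2] the squared distance is at most [4 * eps ^+ 2 / z], the square of the
   claimed bound. *)
have := sqr_hellinger_le mq mv mw q0 v0 w0 z_gt0 z'_gt0 qz vz' dist_le.
set D := (_ * _)%E => D_le.
have D_ge0 : (0 <= D)%E.
  apply: mule_ge0; first by rewrite lee_fin invr_ge0.
  by apply: integral_ge0 => x _; rewrite lee_fin sqr_ge0.
have Dfin : D \is a fin_num by rewrite ge0_fin_numE// (le_lt_trans D_le)// ltry.
have fD0 : 0 <= fine D by rewrite fine_ge0.
move: D_le; rewrite -(fineK Dfin) poweR_EFin !lee_fin powR12_sqrt// => D_le.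
rewrite -(@ler_pXn2r _ 2) ?nnegrE ?sqrtr_ge0// ?divr_ge0 ?mulr_ge0 ?sqrtr_ge0//.
rewrite (sqr_sqrtr fD0) expr_div_n (sqr_sqrtr (ltW z_gt0)).
apply: (le_trans D_le); rewrite ler_pM2r ?invr_gt0//.
by rewrite exprMn mulrA -natrM -natrX.
Qed.
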